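(* Let $w$ be an admissible weight on $\{0\le s\le t\le b\}$ and let $k\in L^1(0,b)$ satisfy the weighted Sonine condition WSC1 with respect to $w$, with associated kernel $K\in L^1(0,b)$ and corresponding function $g$. Suppose $f$ is bounded (and measurable) on $(0,b)$. Then every solution $u\in L^1(0,b)$ of $$u(t)+\frac{1}{g(t,0)}\int_0^t g_2(s,t-s)u(s)\,ds=\frac{1}{g(t,0)}\frac{d}{dt}\int_0^tK(t-s)f(s)\,ds$$ is also a solution of $$\int_0^t w(s,t)k(t-s)u(s)\,ds=f(t),\qquad t\in(0,b].$$
   Context: Fix $b>0$. All functions are real-valued. For a function $q$ of two variables, $q_2$ denotes its partial derivative in the second variable. Equations in $t$ between integrable functions are understood for almost every $t$; $\frac{d}{dt}$ of an integrable function of $t$ is the weak (distributional) derivative on $(0,b)$. Admissible weight: a measurable $w$ on $\{0\le s\le t\le b\}$ such that for each $s$ the map $t\mapsto w(s,t)$ is absolutely continuous on $[s,b]$ (so $w(s,t)=w(s,s)+\int_s^tw_2(s,\theta)\,d\theta$), and (i) there are $0<\mu_*\le\mu^*$ with $\mu_*\le|w(t,t)|\le\mu^*$ for $t\in[0,b]$; (ii) there is $\bar w\in L^1(0,b)$ with $|w_2(s,t)|\le\bar w(t-s)$ for $0\le s\le t\le b$ (a.e. $t$). WSC1: $k\in L^1(0,b)$ satisfies WSC1 with respect to $w$, with associated kernel $K\in L^1(0,b)$ and function $g$, if $$\int_0^t w(s,z+s)K(t-z)k(z)\,dz=g(s,t),\qquad s,t\ge0,\ 0\le s+t\le b,$$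 (for each $s$, for a.e. $t\in(0,b-s)$), where $g$ is a measurable function on $\{s,t\ge 0,\ s+t\le b\}$, absolutely continuous in $t\in[0,b-s]$ for each $s$ (so $g(s,0)$ is the limit as $t\to0^+$), such that (a) there are $0<\nu_*\le\nu^*$ with $\nu_*\le|g(s,0)|\le\nu^*$ for $0\le s\le b$; (b) there is $\bar g\in L^1(0,b)$ with $|g_2(s,t)|\le\bar g(t)$ for $0\le s+t\le b$ (a.e. $t$). *)

(* Defs.v *)
From HB Require Import structures.
From mathcomp Require Import all_boot all_order all_algebra.
From mathcomp Require Import all_classical all_reals all_analysis.

Set Implicit Arguments.
Unset Strict Implicit.
Unset Printing Implicit Defensive.

Import Order.TTheory GRing.Theory Num.Theory.
Import numFieldNormedType.Exports.

Local Open Scope ring_scope.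
Local Open Scope classical_set_scope.

(* The sigma-algebras on R and R * R are the Borel ones.  A function is Lebesgue
   measurable, i.e. measurable for the completion of mu, exactly when it agrees
   mu-almost everywhere with a Borel function. *)
Definition completed_measurable_fun d (T : measurableType d) (R : realType)
    (mu : {measure set T -> \bar R}) (D : set T) (f : T -> R) : Prop :=
  exists2 f' : T -> R, measurable_fun D f' &
    {ae mu, forall x, D x -> f x = f' x}.

Definition absolutely_continuous_on (R : realType) (a b : R) (F : R -> R) : Prop :=
  forall e : R, 0 < e -> exists2 d : R, 0 < d &
    forall (n : nat) (x y : 'I_n -> R),
      (forall i, a <= x i /\ x i <= y i /\ y i <= b) ->
      trivIset [set: 'I_n] (fun i => `]x i, y i[) ->
      \sum_(i < n) (y i - x i) < d ->
      \sum_(i < n) `|F (y i) - F (x i)| < e.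

Definition test_function (R : realType) (b : R) (phi : R -> R) : Prop :=
  (forall (n : nat) (x : R), derivable (derive1n n phi) x 1) /\
  exists2 C : set R, compact C /\ C `<=` `]0, b[ &
    forall x, ~ C x -> phi x = 0.

Definition weak_derivative (R : realType) (b : R) (F h : R -> R) : Prop :=
  [/\ locally_integrable `]0, b[ F, locally_integrable `]0, b[ h &
    forall phi, test_function b phi ->
      \int[@lebesgue_measure R]_(t in `]0, b[) (F t * derive1 phi t) =
      - \int[@lebesgue_measure R]_(t in `]0, b[) (h t * phi t)].

Definition L1 (R : realType) (b : R) (f : R -> R) : Prop :=
  (@lebesgue_measure R).-integrable `]0, b[ (EFin \o f).

(* Functions of two variables are total, but only their values on the indicated
   triangle matter.  The partial derivative q_2(s, t) is derive1 (q s) t; it is only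
   used at almost every t of the interval on which q s is absolutely continuous,
   hence at interior points at which the derivative exists. *)
Record admissible_weight (R : realType) (b : R) (w : R -> R -> R) : Prop := {
  aw_measurable :
    completed_measurable_fun (@lebesgue_measure R \x @lebesgue_measure R)%E
      [set p : R * R | 0 <= p.1 /\ p.1 <= p.2 /\ p.2 <= b]
      (fun p => w p.1 p.2);
  aw_abs_cont : forall s : R, 0 <= s <= b -> absolutely_continuous_on s b (w s);
  aw_diag : exists m M : R, 0 < m <= M /\
    forall t : R, 0 <= t <= b -> m <= `|w t t| <= M;
  aw_deriv : exists2 wbar : R -> R, L1 b wbar &
    forall s : R, 0 <= s <= b ->
      {ae @lebesgue_measure R, forall t, s <= t <= b ->
        `|derive1 (w s) t| <= wbar (t - s)} }.

Record WSC1 (R : realType) (b : R) (w : R -> R -> R) (k K : R -> R)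
    (g : R -> R -> R) : Prop := {
  wsc1_k : L1 b k;
  wsc1_K : L1 b K;
  wsc1_measurable :
    completed_measurable_fun (@lebesgue_measure R \x @lebesgue_measure R)%E
      [set p : R * R | 0 <= p.1 /\ 0 <= p.2 /\ p.1 + p.2 <= b]
      (fun p => g p.1 p.2);
  wsc1_abs_cont :
    forall s : R, 0 <= s <= b -> absolutely_continuous_on 0 (b - s) (g s);
  wsc1_eq : forall s : R, 0 <= s <= b ->
    {ae @lebesgue_measure R, forall t, 0 < t < b - s ->
      \int[@lebesgue_measure R]_(z in `]0, t[) (w s (z + s) * K (t - z) * k z) =
      g s t};
  wsc1_trace : exists m M : R, 0 < m <= M /\
    forall s : R, 0 <= s <= b -> m <= `|g s 0| <= M;
  wsc1_deriv : exists2 gbar : R -> R, L1 b gbar &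
    forall s : R, 0 <= s <= b ->
      {ae @lebesgue_measure R, forall t, 0 <= t <= b - s ->
        `|derive1 (g s) t| <= gbar t} }.

(* The derivative on the right-hand side is a function h: for a merely bounded f
   the convolution need not have a weak derivative that is a function, and its
   existence is part of being a solution. *)
Definition solves_second_kind (R : realType) (b : R) (K : R -> R)
    (g : R -> R -> R) (f u : R -> R) : Prop :=
  exists2 h : R -> R,
    weak_derivative b
      (fun t => \int[@lebesgue_measure R]_(s in `]0, t[) (K (t - s) * f s)) h &
    {ae @lebesgue_measure R, forall t, 0 < t < b ->
      u t + (g t 0)^-1 *
        \int[@lebesgue_measure R]_(s in `]0, t[) (derive1 (g s) (t - s) * u s) =
      (g t 0)^-1 * h t}.

Definition solves_first_kind (R : realType) (b : R) (w : R -> R -> R)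
    (k f u : R -> R) : Prop :=
  {ae @lebesgue_measure R, forall t, 0 < t <= b ->
    \int[@lebesgue_measure R]_(s in `]0, t[) (w s t * k (t - s) * u s) = f t}.

(* Main.v *)
Require Import Defs.
From HB Require Import structures.
From mathcomp Require Import all_boot all_order all_algebra.
From mathcomp Require Import all_classical all_reals all_analysis.
From mathcomp Require Import measurable_realfun ring lra zify.

Set Implicit Arguments.
Unset Strict Implicit.
Unset Printing Implicit Defensive.

Import Order.TTheory GRing.Theory Num.Theory.
Import numFieldNormedType.Exports.

Local Open Scope ring_scope.
Local Open Scope classical_set_scope.

(* Let V t be the left-hand side of the first-kind equation.  By Fubini and the weighted
   Sonine condition the convolution K * V is the integral of g(s, t - s) u(s) over s < t,
   and writing g(s, t - s) = g(s, 0) + (integral of g_2(s, .)) turns it into the integral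
   over ]0, t] of the function H(t) = g(t, 0) u(t) + (integral of g_2(s, t - s) u(s)).  The
   second-kind equation says that H is the weak derivative of K * f.  Since f is bounded,
   K * f tends to 0 at 0, so K * f is also the integral of H over ]0, t]; hence
   K * (V - f) = 0.  Convolving with w(0, .) k gives
   g(0, 0) (V - f) + g_2(0, .) * (V - f) = 0, so V = f by a Gronwall argument. *)

(** * Integration without measurability and Fubini for convolutions *)

(** What shapes the development is that the data are measurable only up to null sets and that the
    partial derivatives are pointwise derivatives of total functions. The hypotheses hold section by
    section (for each [s], at almost every [t]), whereas the equations are wanted at almost every
    [t] with the integral running over [s]; such quantifiers are exchanged only on Borel sets of
    pairs. So [w], [f], the partial derivative of [g] and the trace [g s 0] are each replaced by a
    Borel function, clamped so that its bound holds everywhere, and [k], [K], [u], [f] are extended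
    by 0, which turns integrals over ]0, t[ into convolutions on the line.

    For a fixed [s] the Sonine condition is a plain convolution identity, the weight being absorbed
    in [k]; s = 0 is singled out at the end because it is the case that covers all of ]0, b[. The
    Volterra equation that remains has a kernel and an unknown that are merely integrable, so the
    contraction takes place in an exponentially weighted L1. *)

Section ae_monotone.
Context d (T : measurableType d) (R : realType) (mu : {measure set T -> \bar R}).
Implicit Types P Q : T -> Prop.

Lemma ae_imp P Q : {ae mu, forall x, P x} -> (forall x, P x -> Q x) ->
  {ae mu, forall x, Q x}.
Proof.
by move=> aP PQ; apply: (@filterS _ _ (ae_filter_ringOfSetsType mu) P).
Qed.

Lemma ae_imp2 P1 P2 Q : {ae mu, forall x, P1 x} -> {ae mu, forall x, P2 x} ->
  (forall x, P1 x -> P2 x -> Q x) -> {ae mu, forall x, Q x}.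
Proof.
by move=> a1 a2 PQ; apply: (@filterS2 _ _ (ae_filter_ringOfSetsType mu) P1 P2).
Qed.

Lemma ae_imp3 P1 P2 P3 Q : {ae mu, forall x, P1 x} -> {ae mu, forall x, P2 x} ->
  {ae mu, forall x, P3 x} ->
  (forall x, P1 x -> P2 x -> P3 x -> Q x) -> {ae mu, forall x, Q x}.
Proof.
by move=> a1 a2 a3 PQ; apply: (@filterS3 _ _ (ae_filter_ringOfSetsType mu) P1 P2 P3).
Qed.

End ae_monotone.

Section ae_integral.
Context d (T : measurableType d) (R : realType) (mu : {measure set T -> \bar R}).
Import HBNNSimple.

Lemma ge0_ae_le_integral (f g : T -> \bar R) :
  (forall x, 0 <= f x)%E -> (forall x, 0 <= g x)%E ->
  {ae mu, forall x, f x <= g x}%E -> (\int[mu]_x f x <= \int[mu]_x g x)%E.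
Proof.
move=> f0 g0 [N [mN muN subN]].
rewrite (ge0_integralTE _ f0); apply: ge_ereal_sup => _ [h /= hf <-].
have mNC : measurable (~` N) by exact: measurableC.
rewrite (ge0_integralTE _ g0); apply: ereal_sup_ubound => /=.
exists (proj_nnsfun h mNC) => [x /=|].
  rewrite mindicE; have [xN|xN] := boolP (x \in ~` N); last by rewrite mulr0.
  rewrite mulr1; apply: (le_trans (hf x)).
  by apply: contrapT => nfg; exact: (set_mem xN) (subN _ nfg).
rewrite -!integralT_nnsfun; apply: ge0_ae_eq_integral => //.
- by apply/measurable_EFinP; exact: measurable_funP.
- by apply/measurable_EFinP; exact: measurable_funP.
- by move=> x _; rewrite lee_fin.
- by move=> x _; rewrite lee_fin.
- exists N; split=> // x /=; apply: contra_notP => Nx _.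
  by rewrite mindicE mem_set// mulr1.
Qed.

Lemma ae_eq_integral_nomeas (D : set T) (f g : T -> \bar R) :
  {ae mu, forall x, D x -> f x = g x} ->
  (\int[mu]_(x in D) f x = \int[mu]_(x in D) g x)%E.
Proof.
move=> fg; rewrite integral_mkcond [RHS]integral_mkcond.
have {}fg : {ae mu, forall x, (f \_ D) x = (g \_ D) x}.
  apply: filterS fg => x; rewrite !patchE; case: ifPn => // /set_mem Dx; exact.
rewrite integralE [RHS]integralE; congr (_ - _)%E; apply/eqP; rewrite eq_le;
  by apply/andP; split; apply: ge0_ae_le_integral => //; apply: filterS fg => x;
  rewrite ?funeposE ?funenegE => ->.
Qed.

(* No measurability is needed: the integral of an arbitrary function is a
   supremum over simple functions, which may be cut off on a null set. *)
Lemma ae_eq_Rintegral (D : set T) (f g : T -> R) :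
  {ae mu, forall x, D x -> f x = g x} ->
  \int[mu]_(x in D) f x = \int[mu]_(x in D) g x.
Proof.
move=> fg; congr fine; apply: ae_eq_integral_nomeas.
by apply: filterS fg => x /[apply] ->.
Qed.

(** The extended integral is then infinite, and [fine] sends both infinities to 0. *)
Lemma Rintegral_nonintegrable (D : set T) (f : T -> R) : measurable D ->
  measurable_fun D f -> ~ mu.-integrable D (EFin \o f) ->
  \int[mu]_(x in D) f x = 0.
Proof.
move=> mD mf nif; have : (\int[mu]_(x in D) (f x)%:E)%E \isn't a fin_num.
  rewrite -integral_fin_num_abs//; apply/negP => foo; apply: nif.
  by apply/integrableP; split=> //; exact/measurable_EFinP.
by rewrite /Rintegral fin_numEn => /orP[] /eqP ->.
Qed.

(** Integrability is not assumed: if it fails and [c] is nonzero, both sides take the default value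
    0. *)
Lemma Rintegral_mull (D : set T) (f : T -> R) (c : R) : measurable D ->
  measurable_fun D f ->
  \int[mu]_(x in D) (c * f x) = c * \int[mu]_(x in D) f x.
Proof.
move=> mD mf; have [->|c0] := eqVneq c 0.
  by rewrite mul0r; under eq_Rintegral do rewrite mul0r; rewrite Rintegral_cst// mul0r.
have [fi|nfi] := pselect (mu.-integrable D (EFin \o f)); first exact: RintegralZl.
rewrite (Rintegral_nonintegrable mD mf nfi) mulr0 Rintegral_nonintegrable//.
  exact: measurable_funM.
move=> cfi; apply: nfi.
have := integrableZl mD c^-1 cfi; apply: eq_integrable => // x _ /=.
by rewrite -EFinM mulKf.
Qed.

Lemma integrableM_bounded (D : set T) (h m : T -> R) (M : R) : measurable D ->
  mu.-integrable D (EFin \o h) -> measurable_fun D m ->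
  (forall x, D x -> `|m x| <= M) ->
  mu.-integrable D (EFin \o (fun x => h x * m x)).
Proof.
move=> mD hi mm mM; have mh : measurable_fun D h.
  by apply/measurable_EFinP; exact: (measurable_int _ hi).
have := integrableZl mD M (integrable_abse hi); apply: le_integrable => //.
  by apply/measurable_EFinP; exact: measurable_funM.
move=> x Dx; rewrite /= lee_fin !normrM normr_id mulrC ler_wpM2r//.
by apply: le_trans (mM x Dx) (ler_norm _).
Qed.

End ae_integral.

Lemma measurable_fun_natr_bool d (T : measurableType d) (R : realType) (c : T -> bool) :
  measurable_fun setT c -> measurable_fun setT (fun x => (c x)%:R : R).
Proof.
move=> mc; rewrite (_ : (fun x => _) = fun x => if c x then 1 else 0).
  exact: measurable_fun_ifT.
by apply/funext => x; case: (c x).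
Qed.

(** * Null sets and integrals on a product space *)

Section ae_product.
Context d1 d2 (T1 : measurableType d1) (T2 : measurableType d2) (R : realType).
Variables (m1 : {sigma_finite_measure set T1 -> \bar R})
          (m2 : {sigma_finite_measure set T2 -> \bar R}).

Lemma prod_ae1 (P : T1 * T2 -> Prop) :
  {ae (m1 \x m2)%E, forall p, P p} -> {ae m1, forall x, {ae m2, forall y, P (x, y)}}.
Proof.
move=> [N [mN N0 PN]].
have : (\int[m1]_x `|m2 (xsection N x)| = 0)%E.
  by rewrite -[RHS]N0; apply: eq_integral => x _; rewrite gee0_abs.
have mx : measurable_fun setT (fun x => m2 (xsection N x)).
  exact: measurable_fun_xsection.
move/(ae_eq_integral_abs _ measurableT mx); apply: filterS => x /= /(_ I) Nx.
exists (xsection N x); split=> //; first exact: measurable_xsection.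
by move=> y /= Py; rewrite /xsection /= mem_set //; apply: PN.
Qed.

Lemma prod_ae2 (P : T1 * T2 -> Prop) :
  {ae (m1 \x m2)%E, forall p, P p} -> {ae m2, forall y, {ae m1, forall x, P (x, y)}}.
Proof.
move=> [N [mN N0 PN]].
have : (\int[m2]_y `|m1 (ysection N y)| = 0)%E.
  rewrite -[RHS]N0; apply: esym.
  under [RHS]eq_integral do rewrite gee0_abs//.
  (* The product measure is defined by integrating the sections over x; uniqueness identifies it
     with the one that integrates the sections over y. *)
  exact: (@product_measure_unique _ _ _ _ _ m1 m2 (product_measure2 m1 m2)
    (@product_measure2E _ _ _ _ _ m1 m2)).
have mx : measurable_fun setT (fun x => m1 (ysection N x)).
  exact: measurable_fun_ysection.
move/(ae_eq_integral_abs _ measurableT mx); apply: filterS => y /= /(_ I) Ny.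
exists (ysection N y); split=> //; first exact: measurable_ysection.
by move=> x /= Px; rewrite /ysection /= mem_set //; apply: PN.
Qed.

Lemma ae_prod (A : set (T1 * T2)) : measurable A ->
  {ae m1, forall x, {ae m2, forall y, A (x, y)}} -> {ae (m1 \x m2)%E, forall p, A p}.
Proof.
move=> mA AA; exists (~` A); split => //; first exact: measurableC.
rewrite /= /product_measure1.
have mx : measurable_fun setT (fun x => m2 (xsection (~` A) x)).
  by apply: measurable_fun_xsection; exact: measurableC.
rewrite (ae_eq_integral (cst 0%E))// ?integral0//.
apply: filterS AA => x [N [mN N0 AN]] _ /=; apply: (subset_measure0 _ mN) => //.
  by apply: measurable_xsection; exact: measurableC.
by move=> y; rewrite /xsection /= inE /= => nA; exact: AN.
Qed.

(* Exchanging "almost every" quantifiers requires a measurable set of pairs. *)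
Lemma ae_swap (A : set (T1 * T2)) : measurable A ->
  {ae m1, forall x, {ae m2, forall y, A (x, y)}} ->
  {ae m2, forall y, {ae m1, forall x, A (x, y)}}.
Proof. by move=> mA /(ae_prod mA) /prod_ae2. Qed.

Lemma fubini_Rintegral (f : T1 * T2 -> R) :
  (m1 \x m2)%E.-integrable setT (EFin \o f) ->
  \int[m1]_x \int[m2]_y f (x, y) = \int[m2]_y \int[m1]_x f (x, y).
Proof.
move=> fi; congr fine.
transitivity (\int[m1]_x \int[m2]_y (f (x, y))%:E)%E.
  apply: ae_eq_integral_nomeas; have := ae_integrable1 fi.
  by apply: filterS => x /= fx _; rewrite fineK//; exact: integrable_fin_num fx.
rewrite (Fubini fi); apply: ae_eq_integral_nomeas; have := ae_integrable2 fi.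
by apply: filterS => x /= fx _; rewrite fineK//; exact: integrable_fin_num fx.
Qed.

Lemma integrable_Rintegral2 (f : T1 * T2 -> R) :
  (m1 \x m2)%E.-integrable setT (EFin \o f) ->
  m2.-integrable setT (EFin \o (fun y => \int[m1]_x f (x, y))).
Proof.
move=> fi; have mG := measurable_fubini_G fi.
have : m2.-integrable setT (fubini_G m1 (EFin \o f)).
  have mf := measurable_int _ fi.
  apply/integrableP; split=> //; apply: le_lt_trans ((integrable21ltyP m1 m2 mf).1 fi).
  apply: ge0_le_integral => //=.
  - exact: measurableT_comp.
  - by apply: (measurable_fun_fubini_tonelli_G (fun p => `|(f p)%:E|%E)) => //; exact: measurableT_comp.
  - by move=> y _; apply: le_abse_integral => //; exact: measurableT_comp mf (pair2_measurable y).
apply: le_integrable => //=.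
- by apply/measurable_EFinP; apply: (measurableT_comp _ mG) => //.
- by move=> x _; rewrite /Rintegral /fubini_G /=; case: (\int[m1]_y _)%E => //=; rewrite normr0 ?lexx ?leey.
Qed.

(** The inner integral is [fine] of a difference of two Tonelli integrals, which are measurable
    functions of x whether or not they are finite. *)
Lemma measurable_Rintegral1 (f : T1 * T2 -> R) : measurable_fun setT f ->
  measurable_fun setT (fun x => \int[m2]_y f (x, y)).
Proof.
move=> mf; have mEf : measurable_fun setT (EFin \o f) by exact/measurable_EFinP.
rewrite (_ : (fun x => _) = fine \o (fun x => \int[m2]_y ((EFin \o f)^\+ (x, y)) -
    \int[m2]_y ((EFin \o f)^\- (x, y)))%E).
  apply: (measurableT_comp (fine_measurable measurableT)).
  apply: emeasurable_funB.
    apply: (measurable_fun_fubini_tonelli_F (EFin \o f)^\+%E) => //.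
    exact: measurable_funepos.
  apply: (measurable_fun_fubini_tonelli_F (EFin \o f)^\-%E) => //.
  exact: measurable_funeneg.
apply/funext => x; rewrite /Rintegral /= integralE; congr (fine (_ - _)%E).
  by apply: eq_integral => y _; rewrite !funeposE.
by apply: eq_integral => y _; rewrite !funenegE.
Qed.

End ae_product.

(** * Invariance of Lebesgue measure under translations and reflections *)

Section measure_preserving.
Context (R : realType).
Notation mu := (@lebesgue_measure R).
Variable phi : R -> R.
Hypothesis mphi : measurable_fun setT (phi : measurableTypeR R -> measurableTypeR R).
Hypothesis muphi : forall A : set (measurableTypeR R), measurable A ->
  pushforward mu (phi : measurableTypeR R -> measurableTypeR R) A = mu A.

Lemma integral_comp_preserving (f : R -> \bar R) : measurable_fun setT f ->
  (\int[mu]_x f (phi x) = \int[mu]_x f x)%E.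
Proof.
move=> mf.
suff H (h : R -> \bar R) : measurable_fun setT h -> (forall x, 0 <= h x)%E ->
    (\int[mu]_x h (phi x) = \int[mu]_x h x)%E.
  rewrite [LHS]integralE [RHS]integralE; congr (_ - _)%E.
    rewrite -(H (f^\+)%E) => [||x]; [|exact: measurable_funepos|exact: funepos_ge0].
    by apply: eq_integral => x _; rewrite !funeposE.
  rewrite -(H (f^\-)%E) => [||x]; [|exact: measurable_funeneg|exact: funeneg_ge0].
  by apply: eq_integral => x _; rewrite !funenegE.
move=> mh h0; rewrite -[LHS](ge0_integral_pushforward mphi mu measurableT mh)//.
by apply: eq_measure_integral => A mA _; exact: muphi.
Qed.

Lemma Rintegral_comp_preserving (f : R -> R) : measurable_fun setT f ->
  \int[mu]_x f (phi x) = \int[mu]_x f x.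
Proof.
move=> mf; congr fine; apply: (@integral_comp_preserving (EFin \o f)).
exact/measurable_EFinP.
Qed.

Lemma integrable_comp_preserving (f : R -> R) :
  mu.-integrable setT (EFin \o f) -> mu.-integrable setT (EFin \o (f \o phi)).
Proof.
move=> /integrableP[mf foo]; apply/integrableP; split.
  by apply: (measurableT_comp mf); exact: mphi.
move: foo; rewrite -(@integral_comp_preserving (fun x => `|(EFin \o f) x|%E))//.
exact: measurableT_comp.
Qed.

Lemma ae_comp_preserving (P : R -> Prop) :
  {ae mu, forall x, P x} -> {ae mu, forall x, P (phi x)}.
Proof.
move=> [N [mN N0 PN]]; exists (phi @^-1` N); split.
- by rewrite -[X in measurable X]setTI; exact: mphi.
- by rewrite -[RHS]N0; exact: muphi.
- by move=> x; exact: PN.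
Qed.

End measure_preserving.

Section translation.
Context (R : realType).
Notation mu := (@lebesgue_measure R).
Notation L1R f := (mu.-integrable [set: R] (EFin \o f)).

Lemma measurable_shift (c : R) : measurable_fun setT
  ((fun x => x - c) : measurableTypeR R -> measurableTypeR R).
Proof. exact: measurable_funB. Qed.

Lemma measurable_reflect (c : R) : measurable_fun setT
  ((fun x => c - x) : measurableTypeR R -> measurableTypeR R).
Proof. exact: measurable_funB. Qed.

Lemma lebesgue_measure_shift (c : R) (A : set (measurableTypeR R)) : measurable A ->
  pushforward mu ((fun x => x - c) : measurableTypeR R -> measurableTypeR R) A = mu A.
Proof.
have ms := measurable_shift c.
pose nu : {measure set (measurableTypeR R) -> \bar R} := pushforward mu
  ((fun x => x - c) : measurableTypeR R -> measurableTypeR R).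
move=> mA; suff -> : mu A = nu ms A by [].
apply: (@lebesgue_measure_unique _ (nu ms)) => //= _ [[x y]] _ <-.
rewrite /nu /pushforward /= (_ : _ @^-1` _ = `]x + c, y + c]%classic).
  rewrite !lebesgue_measure_itv/= !lte_fin ltrD2r; case: ifP => // _.
  by rewrite -!EFinB; congr EFin; ring.
by apply/seteqP; split=> z /=; rewrite !in_itv/= ltrBrDr lerBlDr.
Qed.

Lemma lebesgue_measure_reflect (c : R) (A : set (measurableTypeR R)) : measurable A ->
  pushforward mu ((fun x => c - x) : measurableTypeR R -> measurableTypeR R) A = mu A.
Proof.
have ms := measurable_reflect c.
pose nu : {measure set (measurableTypeR R) -> \bar R} := pushforward mu
  ((fun x => c - x) : measurableTypeR R -> measurableTypeR R).
move=> mA; suff -> : mu A = nu ms A by [].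
apply: (@lebesgue_measure_unique _ (nu ms)) => //= _ [[x y]] _ <-.
rewrite /nu /pushforward /= (_ : _ @^-1` _ = `[c - y, c - x[%classic).
  rewrite !lebesgue_measure_itv/= !lte_fin ltrD2l ltrN2; case: ifP => // _.
  by rewrite -!EFinB; congr EFin; ring.
by apply/seteqP; split=> z /=; rewrite !in_itv/= ltrBrDr lerBlDr -ltrBrDl -lerBlDl andbC.
Qed.

Lemma Rintegral_shift (c : R) (f : R -> R) : measurable_fun setT f ->
  \int[mu]_x f (x - c) = \int[mu]_x f x.
Proof.
exact: (Rintegral_comp_preserving (measurable_shift c) (@lebesgue_measure_shift c)).
Qed.

Lemma integral_shift (c : R) (f : R -> \bar R) : measurable_fun setT f ->
  (\int[mu]_x f (x - c)%R = \int[mu]_x f x)%E.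
Proof.
exact: (integral_comp_preserving (measurable_shift c) (@lebesgue_measure_shift c)).
Qed.

Lemma Rintegral_reflect (c : R) (f : R -> R) : measurable_fun setT f ->
  \int[mu]_x f (c - x) = \int[mu]_x f x.
Proof.
exact: (Rintegral_comp_preserving (measurable_reflect c) (@lebesgue_measure_reflect c)).
Qed.

Lemma ae_shift (c : R) (P : R -> Prop) :
  {ae mu, forall x, P x} -> {ae mu, forall x, P (x - c)}.
Proof.
exact: (ae_comp_preserving (measurable_shift c) (@lebesgue_measure_shift c)).
Qed.

Lemma ae_reflect (c : R) (P : R -> Prop) :
  {ae mu, forall x, P x} -> {ae mu, forall x, P (c - x)}.
Proof.
exact: (ae_comp_preserving (measurable_reflect c) (@lebesgue_measure_reflect c)).
Qed.

End translation.

(** * Integral operators dominated by a convolution *)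

Section kernel_operators.
Context (R : realType).
Notation mu := (@lebesgue_measure R).
Notation L1R f := (mu.-integrable [set: R] (EFin \o f)).

Lemma measurable_L1R (f : R -> R) : L1R f -> measurable_fun setT f.
Proof. by move=> /(measurable_int _)/measurable_EFinP. Qed.

Lemma measurable_conv_kernel (a : R -> R) : measurable_fun setT a ->
  measurable_fun setT (fun p : R * R => a (p.2 - p.1)).
Proof.
by move=> ma; apply: (measurableT_comp ma); exact: measurable_funB.
Qed.

(** Tonelli with [t] first: by translation invariance the inner integral is at most |d s| times the
    integral of [c], as in Young's inequality. Domination by c (t - s) is what the weighted kernel,
    [K] itself and the derivative of [g] have in common. *)
Lemma integrable_kernel (c d : R -> R) (N : R * R -> R) :
  L1R c -> L1R d -> measurable_fun setT N ->
  (forall s t, `|N (s, t)| <= c (t - s)) ->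
  (mu \x mu)%E.-integrable setT (EFin \o (fun p : R * R => N p * d p.1)).
Proof.
move=> ci di mN Nc; have mc := measurable_L1R ci; have md := measurable_L1R di.
have mNd : measurable_fun setT (fun p : R * R => N p * d p.1).
  by apply: measurable_funM => //; exact: measurableT_comp.
apply/integrable12ltyP => /=; first exact/measurable_EFinP.
have c0 x : 0 <= c x by have := Nc 0 x; rewrite subr0; exact: le_trans.
have dfin : (\int[mu]_s `|(d s)%:E| < +oo)%E by case/integrableP: di.
have cfin : (\int[mu]_s (c s)%:E)%E \is a fin_num := integrable_fin_num measurableT ci.
apply: (@le_lt_trans _ _ (\int[mu]_s (`|(d s)%:E| * (\int[mu]_t (c t)%:E)))%E).
  apply: ge0_le_integral => //=.
  - by move=> s _; exact: integral_ge0.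
  - have mabs : measurable_fun setT (fun p : R * R => `|(N p * d p.1)%:E|%E).
      by apply: measurableT_comp => //; exact/measurable_EFinP.
    exact: (@measurable_fun_fubini_tonelli_F _ _ _ _ _ mu _ mabs (fun _ => abse_ge0 _)).
  - by apply: emeasurable_funM => //; apply/measurable_EFinP; exact: measurableT_comp.
  - move=> s _.
    rewrite -(@integral_shift _ s (EFin \o c)); last exact/measurable_EFinP.
    rewrite -ge0_integralZl//=; last 2 first.
    + by apply/measurable_EFinP; apply: (measurableT_comp mc); exact: measurable_funB.
    + by move=> t _; rewrite lee_fin.
    apply: ge0_le_integral => //=.
    + apply/measurable_EFinP; apply: measurableT_comp => //.
      exact: measurableT_comp mNd (pair1_measurable s).
    + apply/measurable_EFinP; apply: measurable_funM => //.
      by apply: (measurableT_comp mc); exact: measurable_funB.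
    + by move=> t _; rewrite lee_fin normrM mulrC ler_wpM2l.
rewrite ge0_integralZr//=; last 2 first.
- by apply/measurable_EFinP; exact: measurableT_comp.
- by apply: integral_ge0 => t _; rewrite lee_fin.
by rewrite lte_mul_pinfty//; [exact: integral_ge0|rewrite ge0_fin_numE//; exact: integral_ge0|rewrite ltey_eq cfin].
Qed.

(** The integral [W] of |N (s, r) d s| over [s] is integrable, so its convolution with |a| is finite
    at almost every [t]. At such a [t] the double integral converges absolutely and Fubini
    applies. *)
Lemma kernel_fubini (a c d : R -> R) (N : R * R -> R) :
  L1R a -> L1R c -> L1R d -> measurable_fun setT N ->
  (forall s t, `|N (s, t)| <= c (t - s)) ->
  {ae mu, forall t, \int[mu]_r (a (t - r) * \int[mu]_s (N (s, r) * d s)) =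
    \int[mu]_s (d s * \int[mu]_r (a (t - r) * N (s, r)))}.
Proof.
move=> ai ci di mN Nc; have ma := measurable_L1R ai; have md := measurable_L1R di.
have Ndi := integrable_kernel ci di mN Nc.
have mNd := measurable_int _ Ndi.
pose W r := \int[mu]_s `|N (s, r) * d s|.
have Wi : L1R W.
  apply: (@integrable_Rintegral2 _ _ _ _ _ mu mu (fun p : R * R => `|N p * d p.1|)).
  exact: (integrable_abse Ndi).
have aNi : L1R (fun x => `|a x|) := integrable_abse ai.
have aWi := integrable_kernel aNi Wi (measurable_conv_kernel ma) (fun s t => lexx _).
have := ae_integrable2 aWi; apply: filterS => t /= aWt.
pose H (p : R * R) := a (t - p.2) * N p * d p.1.
have mat : measurable_fun setT (fun r : R => a (t - r)).
  by apply: (measurableT_comp ma); exact: measurable_funB.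
have mH : measurable_fun setT H.
  apply: measurable_funM; last exact: measurableT_comp.
  apply: measurable_funM => //; exact: (measurableT_comp mat measurable_snd).
have Hi : (mu \x mu)%E.-integrable setT (EFin \o H).
  apply/integrable21ltyP; first exact/measurable_EFinP.
  case/integrableP: aWt => _; congr (_ < _)%E; apply: ae_eq_integral_nomeas.
  have := ae_integrable2 (integrable_abse Ndi); apply: filterS => r /= Ndr _.
  rewrite /H; under [RHS]eq_integral do rewrite -mulrA normrM EFinM.
  rewrite /= (@ge0_integralZl _ _ _ mu _ measurableT (fun s : R => `|N (s, r) * d s|%:E))//.
  - rewrite normrM EFinM [`|W r|%R]ger0_norm; last exact: Rintegral_ge0.
    by rewrite /W fineK//; exact: integrable_fin_num Ndr.
  - exact: (measurable_int _ Ndr).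
have := fubini_Rintegral Hi; rewrite /H /= => E; apply/esym.
transitivity (\int[mu]_s \int[mu]_r (a (t - r) * N (s, r) * d s)).
  apply: eq_Rintegral => s _; rewrite -Rintegral_mull//; last first.
    apply: measurable_funM => //; exact: measurableT_comp mN (pair1_measurable s).
  by apply: eq_Rintegral => r _; rewrite mulrC.
rewrite E; apply: eq_Rintegral => r _; rewrite -Rintegral_mull//; last first.
  by apply: measurable_funM => //; exact: measurableT_comp mN (pair2_measurable r).
by apply: eq_Rintegral => s _; rewrite mulrA.
Qed.

End kernel_operators.

(** * Absolutely continuous functions *)

Section absolute_continuity.
Context (R : realType).
Implicit Types (a b : R) (F : R -> R).

(** The refinement of a family of intervals is naturally indexed by dependent pairs, hence the
    arbitrary finite index type. *)
Lemma absolutely_continuous_fin a b F : absolutely_continuous_on a b F ->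
  forall e : R, 0 < e -> exists2 d : R, 0 < d &
    forall (I : finType) (x y : I -> R),
      (forall i, a <= x i /\ x i <= y i /\ y i <= b) ->
      trivIset [set: I] (fun i => `]x i, y i[) ->
      \sum_(i : I) (y i - x i) < d ->
      \sum_(i : I) `|F (y i) - F (x i)| < e.
Proof.
move=> FAC e e0; have [d d0 Hd] := FAC e e0; exists d => // I x y xy tI sI.
rewrite (big_enum_val (A := I) (fun i => `|F (y i) - F (x i)|)) /=.
apply: (Hd _ (x \o enum_val) (y \o enum_val)) => [i /=|i j _ _ /= ij|].
- exact: xy.
- by apply: enum_val_inj; exact: tI.
- by rewrite -(big_enum_val (A := I) (fun i => y i - x i)).
Qed.

Lemma absolutely_continuousB a b F G : absolutely_continuous_on a b F ->
  absolutely_continuous_on a b G -> absolutely_continuous_on a b (F \- G).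
Proof.
move=> FAC GAC e e0; have e20 : 0 < e / 2 by rewrite divr_gt0.
have [d1 d10 H1] := FAC _ e20; have [d2 d20 H2] := GAC _ e20.
exists (Num.min d1 d2); first by rewrite lt_min d10.
move=> n x y xy tI; rewrite lt_min => /andP[s1 s2].
rewrite [e]splitr; apply: le_lt_trans (ltrD (H1 n x y xy tI s1) (H2 n x y xy tI s2)).
rewrite -big_split /=; apply: ler_sum => i _.
have -> : (F \- G) (y i) - (F \- G) (x i) = (F (y i) - F (x i)) - (G (y i) - G (x i)).
  by rewrite /=; ring.
exact: ler_normB.
Qed.

Lemma absolutely_continuous_modulus a b F : absolutely_continuous_on a b F ->
  forall e : R, 0 < e -> exists2 d : R, 0 < d &
    forall x y, a <= x -> x <= y -> y <= b -> y - x < d -> `|F y - F x| < e.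
Proof.
move=> FAC e e0; have [d d0 Hd] := FAC e e0; exists d => // x y ax xy yb yx.
have := Hd 1%N (fun=> x) (fun=> y); rewrite !big_ord1; apply=> //.
by move=> i j _ _ _; rewrite (ord1 i) (ord1 j).
Qed.

Section partition.
Variables (a b : R) (s : seq R).
Hypothesis abs : itv_partition a b s.

Let x (i : nat) := nth b (a :: s) i.

Lemma itv_partition_nth_le_nth i j : (i <= j)%N -> (j <= size s)%N -> x i <= x j.
Proof.
rewrite leq_eqVlt => /predU1P[->//|ij js]; apply: ltW.
case: abs => ps _; rewrite /x; apply: sorted_ltn_nth => //; try exact: lt_trans; rewrite inE /=.
  exact: ltn_trans ij _.
Qed.

Lemma itv_partition_trivIset : trivIset [set: 'I_(size s)] (fun i => `]x i, x i.+1[).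
Proof.
suff H (i j : 'I_(size s)) : (i < j)%N -> ~ (`]x i, x i.+1[ `&` `]x j, x j.+1[ !=set0).
  move=> i j _ _ ij; apply: val_inj; case: (ltngtP i j) => // /H; first exact.
  by rewrite setIC.
move=> ij [z [/=]]; rewrite !in_itv/= => /andP[_ zi] /andP[jz _].
have := lt_trans jz zi; rewrite ltNge => /negP; apply.
by apply: itv_partition_nth_le_nth => //; exact: ltnW.
Qed.

Lemma itv_partition_sum : \sum_(i < size s) (x i.+1 - x i) = b - a.
Proof.
rewrite -(big_mkord xpredT (fun i => x i.+1 - x i)) telescope_sumr//.
by rewrite /x (itv_partition_nth_size _ abs).
Qed.

End partition.

(** With [d] chosen for e = 1, the variation over an interval shorter than [d] is at most 1, and
    finitely many steps of length d / 2 exhaust [a, b]. *)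
Lemma absolutely_continuous_bounded_variation a b F : a <= b ->
  absolutely_continuous_on a b F -> bounded_variation a b F.
Proof.
move=> ab FAC; have [d d0 Hd] := FAC 1 ltr01.
have H c c' : a <= c -> c <= c' -> c' <= b -> c' - c < d ->
    (total_variation c c' F <= 1%:E)%E.
  move=> ac cc' c'b c'c; apply: ge_ereal_sup => _ [_ [s cs] <- <-].
  rewrite lee_fin /variation big_mkord; apply: ltW.
  apply: (Hd (size s) (fun i => nth c' (c :: s) i) (fun i => nth c' (c :: s) i.+1)).
  - move=> i; have is_ := ltn_ord i; split; [|split].
    + by apply: le_trans ac _; apply: itv_partition_nth_ge => //; exact: ltnW.
    + by apply: itv_partition_nth_le_nth.
    + by apply: le_trans c'b; apply: itv_partition_nth_le.
  - exact: itv_partition_trivIset.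
  - by rewrite (itv_partition_sum cs).
suff K n c : a <= c -> c <= b -> c - a <= n%:R * (d / 2) ->
    (total_variation a c F <= n%:R%:E)%E.
  apply/(bounded_variationP _ ab); rewrite ge0_fin_numE ?total_variation_ge0//.
  pose n := (Num.truncn ((b - a) / (d / 2))).+1.
  apply: (le_lt_trans (K n b ab (lexx _) _)); last exact: ltry.
  by rewrite -ler_pdivrMr ?divr_gt0//; apply/ltW/truncnS_gt.
elim: n c => [|n IH] c ac cb.
  by rewrite mul0r subr_le0 => ca; rewrite (@le_anti _ _ a c) ?ac// total_variationxx.
move=> can; pose c0 := Num.max a (c - d / 2).
have d20 : 0 < d / 2 by rewrite divr_gt0.
have ac0 : a <= c0 by rewrite le_max lexx.
have c0c : c0 <= c by rewrite ge_max ac gerBl ltW.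
rewrite (total_variationD _ ac0 c0c) -addn1 natrD EFinD leeD//.
  apply: IH => //; first exact: le_trans cb.
  rewrite lerBlDr ge_max; apply/andP; split.
    by rewrite lerDr mulr_ge0// ltW.
  by move: can; rewrite -addn1 natrD mulrDl mul1r; lra.
apply: H => //; rewrite ltrBlDr -ltrBlDl /c0 lt_max; apply/orP; right.
by rewrite ltrD2l ltrN2 ltr_pdivrMr// ltr_pMr// ltr1n.
Qed.

Lemma fine_total_variationB a b F x y : bounded_variation a b F ->
  a <= x -> x <= y -> y <= b ->
  [/\ bounded_variation x y F & fine (total_variation a y F) -
    fine (total_variation a x F) = fine (total_variation x y F)].
Proof.
move=> FBV ax xy yb; have ay := le_trans ax xy; have xb := le_trans xy yb.
have BVay := bounded_variationl ay yb FBV.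
have BVax := bounded_variationl ax xb FBV.
have BVxy := bounded_variationr ax xy BVay.
split=> //; rewrite (total_variationD F ax xy) fineD; last 2 first.
- exact/bounded_variationP.
- exact/bounded_variationP.
by rewrite addrAC subrr add0r.
Qed.

Lemma total_variation_adherent a b F (e : R) : a <= b -> bounded_variation a b F ->
  0 < e -> exists2 s, itv_partition a b s &
  fine (total_variation a b F) - e < variation a b F s.
Proof.
move=> ab FBV e0; have tvfin : total_variation a b F \is a fin_num by exact/bounded_variationP.
have [_ [_ [s abs <-] <-] es] := ub_ereal_sup_adherent e0 tvfin.
by exists s => //; rewrite -lte_fin EFinB fineK.
Qed.

(* Each interval of a family is replaced by the cells of a partition that nearly
   realizes the variation of [F] on it; the refined family is still disjoint. *)
Lemma absolutely_continuous_total_variation a b F : a <= b ->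
  absolutely_continuous_on a b F ->
  absolutely_continuous_on a b (fun x => fine (total_variation a x F)).
Proof.
move=> ab FAC; have FBV := absolutely_continuous_bounded_variation ab FAC.
move=> e e0; have e20 : 0 < e / 2 by rewrite divr_gt0.
have [d d0 Hd] := absolutely_continuous_fin FAC e20.
exists d => // n x y xy tI sd.
(* The loss allowed on each of the [n] intervals; [n.+1] keeps it positive for the empty family and
   the total loss at most e / 2. *)
have n0 : 0 < e / (2 * n.+1%:R) by rewrite divr_gt0// mulr_gt0.
have /choice[s Hs] i : exists s, itv_partition (x i) (y i) s /\
    fine (total_variation (x i) (y i) F) - e / (2 * n.+1%:R) < variation (x i) (y i) F s.
  have [ax [xiy yb]] := xy i; have [BVi _] := fine_total_variationB FBV ax xiy yb.
  by have [s ? ?] := total_variation_adherent xiy BVi n0; exists s.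
pose I : finType := {i : 'I_n & 'I_(size (s i))}.
pose X (p : I) := nth (y (tag p)) (x (tag p) :: s (tag p)) (tagged p).
pose Y (p : I) := nth (y (tag p)) (x (tag p) :: s (tag p)) (tagged p).+1.
have XY (p : I) : x (tag p) <= X p /\ X p <= Y p /\ Y p <= y (tag p).
  case: p => i j; rewrite /X /Y /=; have [ps _] := Hs i; have js := ltn_ord j.
  split; [|split].
  - by apply: itv_partition_nth_ge => //; exact: ltnW.
  - exact: (itv_partition_nth_le_nth ps (leqnSn j) js).
  - exact: (@itv_partition_nth_le _ _ _ _ _ j.+1 js ps).
have : \sum_(p : I) `|F (Y p) - F (X p)| < e / 2.
  apply: Hd.
  - move=> p; have [h1 [h2 h3]] := XY p; have [k1 [k2 k3]] := xy (tag p).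
    by split; [exact: le_trans k1 h1|split=> //; exact: le_trans h3 k3].
  - move=> p q _ _ [z []] /=; rewrite !in_itv/= => /andP[pz zp] /andP[qz zq].
    have pq : tag p = tag q.
      apply: tI => //; exists z; split=> /=; rewrite in_itv/=.
        have [h1 [h2 h3]] := XY p.
        by apply/andP; split; [exact: le_lt_trans h1 pz|exact: lt_le_trans zp h3].
      have [h1 [h2 h3]] := XY q.
      by apply/andP; split; [exact: le_lt_trans h1 qz|exact: lt_le_trans zq h3].
    case: p q pq pz zp qz zq => i j [i' j'] /= ii'; case: _ / ii' j' => j' pz zp qz zq.
    congr existT; have [ps _] := Hs i.
    apply: (itv_partition_trivIset ps) => //; exists z.
    by split=> /=; rewrite in_itv/=; apply/andP; split.
  - move: sd; congr (_ < _); rewrite -(sig_big_dep (fun i => true) (fun i j => true)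
      (fun i (j : 'I_(size (s i))) => nth (y i) (x i :: s i) j.+1 - nth (y i) (x i :: s i) j)) /=.
    by apply: eq_bigr => i _; have [ps _] := Hs i; rewrite (itv_partition_sum ps).
rewrite -(sig_big_dep (fun i => true) (fun i j => true)
   (fun i (j : 'I_(size (s i))) => `|F (nth (y i) (x i :: s i) j.+1) - F (nth (y i) (x i :: s i) j)|)) /=.
under eq_bigr => i _ do
  rewrite -(big_mkord xpredT (fun j => `|F (nth (y i) (x i :: s i) j.+1) - F (nth (y i) (x i :: s i) j)|)).
move=> He; rewrite [e]splitr.
apply: (@le_lt_trans _ _ (\sum_(i < n) (variation (x i) (y i) F (s i) + e / (2 * n.+1%:R)))).
  apply: ler_sum => i _; have [ax [xiy yb]] := xy i.
  have [BVi ->] := fine_total_variationB FBV ax xiy yb.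
  rewrite ger0_norm ?fine_ge0 ?total_variation_ge0//.
  by rewrite -lerBlDr; apply: ltW; have [] := Hs i.
rewrite big_split /=; apply: ltr_leD => //.
rewrite sumr_const card_ord -[_ *+ n]mulr_natr.
rewrite invfM mulrA -mulrA ler_piMr ?(ltW e20)// mulrC ler_pdivrMr ?mul1r ?ler_nat//.
Qed.

End absolute_continuity.

(** * Stieltjes measures and their densities *)

Section density.
Context (R : realType).
Notation mu := (@lebesgue_measure R).

Lemma lebesgue_stieltjes_measure_itvoc (G : cumulative R R) (x y : R) : x <= y ->
  lebesgue_stieltjes_measure G `]x, y]%classic = (G y - G x)%:E.
Proof.
move=> xy; rewrite /lebesgue_stieltjes_measure /measure_extension/=.
rewrite measurable_mu_extE//; last exact: is_ocitv.
exact: (wlength_itv_bnd G false false xy).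
Qed.

Lemma open_bounded_interval (I : set R) (A B : R) : open I -> is_interval I ->
  I `<=` `]A, B[ -> I !=set0 ->
  I = `]inf I, sup I[%classic /\ [/\ A <= inf I, inf I <= sup I & sup I <= B].
Proof.
move=> oI iI IAB [z Iz].
have lI : has_lbound I by exists A => x /IAB /=; rewrite in_itv/= => /andP[/ltW].
have uI : has_ubound I by exists B => x /IAB /=; rewrite in_itv/= => /andP[_ /ltW].
split.
  by move/interior_id : (oI) => oI'; rewrite -[LHS]oI' interval_bounded_interior.
split.
- apply: le_inf_supW || apply: lb_le_inf; first by exists z.
  by move=> x /IAB /=; rewrite in_itv/= => /andP[/ltW].
- by apply: (@le_trans _ _ z); [exact: ge_inf|exact: ub_le_sup].
- apply: ge_sup; first by exists z.
  by move=> x /IAB /=; rewrite in_itv/= => /andP[_ /ltW].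
Qed.

Section cumulative.
Variables (G : cumulative R R) (a b : R).
Hypothesis ab : a <= b.
Hypothesis GAC : absolutely_continuous_on a b G.

Let nuoo : (lebesgue_stieltjes_measure G `]a, b]%classic < +oo)%E.
Proof. by rewrite lebesgue_stieltjes_measure_itvoc// ltry. Qed.

Let mab : measurable (`]a, b]%classic : set (measurableTypeR R)).
Proof. exact: measurable_itv. Qed.

Let nu : {finite_measure set (measurableTypeR R) -> \bar R} :=
  mfrestr mab nuoo.

Let clamp (x : R) := Num.min b (Num.max a x).

(** A null set lies in an open set of measure below [d], whose components are countably many
    disjoint intervals. Absolute continuity bounds the sum of the increments of [G] over any
    finitely many of them by [e], and countable additivity passes to the limit. *)
Lemma cumulative_dominates : nu `<< mu.
Proof.
apply/null_content_dominatesP => A mA A0.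
apply/eqP; rewrite eq_le measure_ge0 andbT; apply/lee_addgt0Pr => e e0; rewrite add0e.
have [d d0 Hd] := absolutely_continuous_fin GAC e0.
have Aoo : (mu A < +oo)%E by rewrite A0 ltry.
have [U [oU AU Ud]] := lebesgue_regularity_outer mA Aoo d0.
have mU : measurable U := open_measurable oU.
have {}Ud : (mu U < d%:E)%E.
  rewrite (@le_lt_trans _ _ (mu (U `\` A)))//.
  rewrite -{1}(setDUK AU) measureU//; last by rewrite setDE setICA setICr setI0.
    by move: A0 => /= ->; rewrite add0e.
  exact: measurableD.
(* Cutting down to a bounded neighbourhood of [a, b] gives every nonempty component the form ]inf,
   sup[ with real endpoints. *)
pose W := U `&` `]a - 1, b + 1[%classic.
have oW : open W by apply: openI => //; exact: itv_open.
pose J := open_disjoint_itv oW.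
have JW n : J n `<=` W by rewrite [W](open_disjoint_itv_bigcup oW); exact: bigcup_sup.
have oJ n : open (J n) := @open_disjoint_itv_open _ _ oW n.
have mJ n : measurable (J n) := open_measurable (oJ n).
have tJ : trivIset setT J := @open_disjoint_itv_trivIset _ _ oW.
(* A component may stick out of [a, b], where absolute continuity is not assumed; clamping its
   endpoints loses no mass because [nu] is carried by ]a, b]. *)
have nuJ n : exists xy : R * R, [/\ a <= xy.1, xy.1 <= xy.2, xy.2 <= b,
    `]xy.1, xy.2[ `<=` J n & (nu (J n) <= (G xy.2 - G xy.1)%:E)%E].
  have [->|/set0P J0] := eqVneq (J n) set0.
    by exists (a, a); split; rewrite //= ?set_itvoo0// measure0 subrr.
  have [JE [aJ JJ Jb]] := open_bounded_interval (oJ n)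
    (@open_disjoint_itv_is_interval _ _ oW n) (subset_trans (JW n) (@subIsetr _ _ _)) J0.
  rewrite -/(J n) in JE aJ JJ Jb.
  have cl : clamp (inf (J n)) <= clamp (sup (J n)).
    rewrite /clamp le_min ge_min lexx /= ge_min; apply/orP; right.
    by rewrite ge_max le_max lexx /= le_max JJ orbT.
  exists (clamp (inf (J n)), clamp (sup (J n))); split => //=.
  - by rewrite /clamp le_min ab le_max lexx.
  - by rewrite /clamp ge_min lexx.
  - rewrite [X in _ `<=` X]JE => x /=; rewrite !in_itv/= /clamp.
    by rewrite gt_min lt_min gt_max !lt_max; lra.
  - rewrite -lebesgue_stieltjes_measure_itvoc//; apply: le_measure; rewrite ?inE//.
exact: (measurableI _ _ (mJ n) mab).
    rewrite [X in X `&` _]JE => x /= []; rewrite !in_itv/= /clamp.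
    by rewrite gt_min le_min gt_max !le_max; lra.
have /choice[xy Hxy] := nuJ.
have -> : nu A = nu (A `&` `]a, b]).
  by rewrite /nu /= /mfrestr /mrestr -setIA setIid.
apply: (@le_trans _ _ (nu W)).
  apply: le_measure; rewrite ?inE//; [exact: measurableI|exact: open_measurable|].
  move=> x [/AU Ux /=]; rewrite !in_itv/= => /andP[ax xb]; split=> //=.
  by rewrite in_itv/=; apply/andP; split; lra.
rewrite [W](open_disjoint_itv_bigcup oW) -/J.
have mUJ : measurable (\bigcup_n J n) by exact: bigcup_measurable.
have nuS := @measure_sigma_additive _ _ _ nu J mJ tJ.
rewrite -(cvg_lim _ nuS)//; apply: lime_le; first by apply/cvg_ex; eexists; exact: nuS.
apply: nearW => n; rewrite big_mkord.
apply: (@le_trans _ _ (\sum_(i < n) (G (xy i).2 - G (xy i).1)%:E)%E).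
  by apply: lee_sum => i _; have [] := Hxy i.
rewrite sumEFin lee_fin; apply: ltW.
apply: le_lt_trans (Hd _ (fun i : 'I_n => (xy i).1) (fun i => (xy i).2) _ _ _).
- by apply: ler_sum => i _; exact: ler_norm.
- by move=> i; have [] := Hxy i.
- move=> i j _ _ [z [zi zj]]; apply: val_inj; apply: (tJ i j) => //; exists z.
  by have [_ _ _ Ji _] := Hxy i; have [_ _ _ Jj _] := Hxy j; split; [exact: Ji|exact: Jj].
- rewrite -lte_fin; apply: le_lt_trans Ud.
  apply: (@le_trans _ _ (mu (\bigcup_n J n))); last first.
    apply: le_measure; rewrite ?inE//.
    by rewrite -(open_disjoint_itv_bigcup oW); exact: subIsetl.
  rewrite -sumEFin.
  apply: (@le_trans _ _ (\sum_(i < n) mu (J i))%E).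
    apply: lee_sum => i _; have [_ xyi _ Ji _] := Hxy i.
    apply: (@le_trans _ _ (mu `](xy i).1, (xy i).2[%classic)).
      rewrite lebesgue_measure_itv/= lte_fin -EFinB.
      by case: ltP => // yx; rewrite lee_fin subr_le0.
    by apply: le_measure => //; rewrite inE; [exact: measurable_itv|exact: mJ].
  rewrite -(big_mkord xpredT (fun i => mu (J i))).
  rewrite [leRHS](measure_semi_bigcup mu mJ tJ mUJ).
  exact: nneseries_lim_ge.
Qed.

Lemma cumulative_density : exists2 phi : R -> R,
  mu.-integrable setT (EFin \o phi) &
  forall x, a <= x <= b -> G x - G a = \int[mu]_(t in `]a, x]) phi t.
Proof.
have [phi [phi0 phifin phii nuE]] := @radon_nikodym_sigma_finite _ _ _ mu nu cumulative_dominates.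
exists (fine \o phi).
  by apply: eq_integrable phii => // x _ /=; rewrite fineK.
move=> x /andP[ax xb]; rewrite /Rintegral.
under eq_integral do rewrite /= fineK//.
rewrite -nuE// /nu /= /mfrestr /mrestr setIidl; last first.
  by move=> y /=; rewrite !in_itv/= => /andP[-> /le_trans]; exact.
by rewrite lebesgue_stieltjes_measure_itvoc.
Qed.

End cumulative.

End density.

Section absolutely_continuous_FTC.
Context (R : realType).
Notation mu := (@lebesgue_measure R).
Notation L1R f := (mu.-integrable [set: R] (EFin \o f)).

(** Clamping the argument to [a, b] extends [V] by constants to a continuous nondecreasing function
    on the line, as a Stieltjes measure requires. The clamp is 1-Lipschitz, so the modulus of
    continuity of [V] carries over. *)
Lemma nondecreasing_density (a b : R) (V : R -> R) : a <= b ->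
  {in `[a, b]%R &, nondecreasing_fun V} -> absolutely_continuous_on a b V ->
  exists2 phi : R -> R, L1R phi &
  forall x, a <= x <= b -> V x - V a = \int[mu]_(t in `]a, x]) phi t.
Proof.
move=> ab ndV VAC; pose clamp (x : R) := Num.min b (Num.max a x).
have clab x : a <= clamp x <= b.
  by rewrite /clamp le_min ab le_max lexx /= ge_min lexx.
have clid x : a <= x <= b -> clamp x = x.
  by move=> /andP[ax xb]; rewrite /clamp (max_idPr ax) (min_idPr xb).
have clnd x y : x <= y -> clamp x <= clamp y.
  rewrite /clamp => xy; rewrite le_min ge_min lexx /= ge_min; apply/orP; right.
  by rewrite ge_max le_max lexx /= le_max xy orbT.
have cllip x y : x <= y -> clamp y - clamp x <= y - x.
  rewrite /clamp => xy; have [] := leP a x; have [] := leP a y => //= *; 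
  rewrite /Num.min; repeat case: ifPn => ?; lra.
pose G x := V (clamp x).
have Gnd : nondecreasing G.
  by move=> x y xy; apply: ndV; rewrite ?in_itv/= ?clab//; 
 exact: clnd.
have Grc : continuous G.
  move=> x; apply/cvgrPdist_lt => e e0.
  have [d d0 Hd] := absolutely_continuous_modulus VAC e0.
  near=> y; have yx : `|x - y| < d by near: y; exact: cvgr_dist_lt.
  have /andP[ay yb] := clab y; have /andP[ax xb] := clab x.
  have [xy|/ltW xy] := leP x y; rewrite /G.
    rewrite distrC Hd ?clnd// (le_lt_trans (cllip _ _ xy))//.
    by rewrite -[X in X < _]ger0_norm ?subr_ge0// distrC.
  rewrite Hd ?clnd// (le_lt_trans (cllip _ _ xy))//.
  by rewrite -[X in X < _]ger0_norm ?subr_ge0.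
pose Gm := isCumulative.Build R _ R G Gnd (right_continuousW Grc).
pose Gc : cumulative R R := HB.pack G Gm.
have GcAC : absolutely_continuous_on a b Gc.
  move=> e e0; have [d d0 Hd] := VAC e e0; exists d => // n x y xy tI sd.
  rewrite [X in X < _](_ : _ = \sum_(i < n) `|V (y i) - V (x i)|); first exact: Hd.
  apply: eq_bigr => i _; have [ax [xy' yb]] := xy i.
  by rewrite /Gc /= /G !clid//; [rewrite ax (le_trans xy')|rewrite (le_trans ax)].
have [phi phii phiE] := cumulative_density ab GcAC; exists phi => // x axb.
by rewrite -phiE// /Gc /= /G !clid// lexx ab.
Unshelve. all: by end_near. Qed.

(** Jordan decomposition F = V - (V - F), where [V] is the total variation from [a]: both terms are
    nondecreasing and absolutely continuous. *)
Lemma absolutely_continuous_density (a b : R) (F : R -> R) : a <= b ->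
  absolutely_continuous_on a b F ->
  exists2 phi : R -> R, L1R phi &
  forall x, a <= x <= b -> F x - F a = \int[mu]_(t in `]a, x]) phi t.
Proof.
move=> ab FAC; pose V x := fine (total_variation a x F).
have FBV := absolutely_continuous_bounded_variation ab FAC.
have VAC : absolutely_continuous_on a b V := absolutely_continuous_total_variation ab FAC.
have VE x y : a <= x -> x <= y -> y <= b -> `|F y - F x| <= V y - V x.
  move=> ax xy yb; have [BVxy ->] := fine_total_variationB FBV ax xy yb.
  rewrite -lee_fin fineK; last exact/bounded_variationP.
  exact: total_variation_ge.
have [||phi1 phi1i phi1E] := @nondecreasing_density a b V ab.
- move=> x y; rewrite !in_itv/= => /andP[ax xb] /andP[ay yb] xy.
  by rewrite -subr_ge0; apply: le_trans (VE _ _ ax xy yb).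
- exact: VAC.
have [||phi2 phi2i phi2E] := @nondecreasing_density a b (V \- F) ab.
- move=> x y; rewrite !in_itv/= => /andP[ax xb] /andP[ay yb] xy.
  by have := le_trans (ler_norm _) (VE _ _ ax xy yb); lra.
- exact: absolutely_continuousB.
exists (phi1 \- phi2) => [|x axb].
  have := integrableB measurableT phi1i phi2i.
  by apply: eq_integrable => // x _; rewrite /= EFinB.
rewrite RintegralB//=; last 2 first.
- exact: integrableS phi1i.
- exact: integrableS phi2i.
by rewrite -phi1E// -phi2E//=; ring.
Qed.

Lemma near_eq_derive1 (f g : R -> R) (x : R) : (\near x, f x = g x) ->
  derivable f x 1 -> derivable g x 1 /\ derive1 g x = derive1 f x.
Proof.
move=> fg df; have dg : derivable g x 1 by apply: near_eq_derivable df; rewrite ?oner_neq0.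
by split=> //; rewrite !derive1E; apply: near_eq_derive; rewrite ?oner_neq0//; apply: filterS fg.
Qed.

(** Lebesgue differentiation applies to the primitive of the density, with which [F] agrees up to
    the constant [F a] near every interior point; this links the density to the pointwise
    [derive1]. *)
Lemma absolutely_continuous_FTC (a b : R) (F : R -> R) : a <= b ->
  absolutely_continuous_on a b F ->
  exists phi : R -> R, [/\ L1R phi,
   forall x, a <= x <= b -> F x - F a = \int[mu]_(t in `]a, x]) phi t &
   {ae mu, forall x, a < x < b -> derivable F x 1 /\ derive1 F x = phi x}].
Proof.
move=> ab FAC; have [phi phii phiE] := absolutely_continuous_density ab FAC.
exists phi; split => //.
have phil : locally_integrable [set: R] phi := open_integrable_locally openT phii.
have phia y : mu.-integrable [set` Interval (BRight a) (BRight y)] (EFin \o phi).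
  by apply: integrableS phii => //; exact: measurable_itv.
have := @FTC1 R phi (BRight a) phia phil.
apply: filterS; first exact: (ae_filter_ringOfSetsType mu).
move=> x /= Hx /andP[ax xb]; have [//|dF0 <-] := Hx.
set F0 := (fun y => _) in dF0 *.
pose F1 : R -> R := F0 + cst (F a).
have dF1 : derivable F1 x 1 := derivableD dF0 (derivable_cst (F a) x 1).
have [|dF ->] := @near_eq_derive1 F1 F x _ dF1.
  near=> y; change (F0 y + F a = F y); rewrite /F0 -phiE ?subrK//.
  by apply/andP; split; apply: ltW; near: y; [exact: lt_nbhsr|exact: lt_nbhsl].
by split=> //; rewrite !derive1E (deriveD dF0 (derivable_cst (F a) x 1)) derive_cst addr0.
Unshelve. all: by end_near. Qed.

End absolutely_continuous_FTC.

(** * The du Bois-Reymond lemma *)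

Section smooth_step.
Context (R : realType).
Implicit Types (f g : R -> R) (x : R).

(** The classical function exp (- 1/x), flat at 0, with a factor x^-n that makes the family stable
    under differentiation up to linear combinations. *)
Definition flat (n : nat) (x : R) : R :=
  if 0 < x then x ^- n * expR (- x^-1) else 0.

Lemma flat_gt0 n x : 0 < x -> 0 < flat n x.
Proof. by move=> x0; rewrite /flat x0 mulr_gt0 ?expR_gt0// invr_gt0 exprn_gt0. Qed.

Lemma flat_le0 n x : x <= 0 -> flat n x = 0.
Proof. by move=> x0; rewrite /flat ltNge x0. Qed.

Lemma flat_ge0 n x : 0 <= flat n x.
Proof. by have [/(flat_gt0 n)/ltW//|/(flat_le0 n)->] := ltP 0 x. Qed.

(** One term of the exponential series, exp (1/x) >= x^-(n+2) / (n+2)!, absorbs the pole and leaves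
    a factor x^2, which gives derivative 0 at the origin. *)
Lemma flat_quadratic n x : flat n x <= (n.+2)`!%:R * x ^+ 2.
Proof.
have [x0|x0] := ltP 0 x; last by rewrite flat_le0// mulr_ge0// sqr_ge0.
rewrite /flat x0 expRN; have y0 : 0 <= x^-1 by rewrite invr_ge0 ltW.
have := expR_ge1Dxn n.+1 y0; rewrite exprVn => h.
have xn2 : 0 < x ^+ n.+2 by rewrite exprn_gt0.
rewrite ler_pdivrMr ?expR_gt0// -ler_pdivrMl; last first.
  by rewrite mulr_gt0 ?exprn_gt0// ltr0n fact_gt0.
apply: le_trans h; apply: ler_wpDl => //; rewrite !exprS.
by rewrite le_eqVlt; apply/orP; left; apply/eqP; field; rewrite pnatr_eq0 -lt0n fact_gt0 expf_neq0 ?gt_eqF.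
Qed.

Lemma is_derive0_quadratic f (C : R) : (forall x, `|f x| <= C * x ^+ 2) ->
  is_derive (0 : R) 1 f 0.
Proof.
move=> fC; have f0 : f 0 = 0.
  by apply/normr0_eq0/le_anti; rewrite normr_ge0 (le_trans (fC 0))// expr0n mulr0.
have C0 : 0 <= C by have := le_trans (normr_ge0 _) (fC 1); rewrite expr1n mulr1.
suff H : (fun h : R => h^-1 *: (f (h *: 1 + 0) - f 0)) @ 0^' --> (0 : R).
  by apply: DeriveDef; [apply/cvg_ex; exists 0|apply/cvg_lim].
apply/cvgrPdist_le => e e0; near=> h.
have h0 : h != 0 by near: h; exact: nbhs_dnbhs_neq.
rewrite sub0r normrN f0 subr0 addr0 /GRing.scale /= mulr1 normrM normfV.
rewrite ler_pdivrMl ?normr_gt0//; apply: (le_trans (fC h)).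
rewrite -real_normK ?num_real// expr2 mulrA mulrC; apply: ler_wpM2l => //.
have hd : `|h| <= e / (C + 1).
  near: h; apply: nbhs_dnbhs; apply: filterS (nbhsx_ballx (0 : R) (e / (C + 1)) _).
    by move=> y; rewrite /ball /= sub0r normrN => /ltW.
  by rewrite divr_gt0// ltr_wpDl.
apply: (@le_trans _ _ (C * (e / (C + 1)))); first exact: ler_wpM2l.
by rewrite mulrCA ler_piMr ?(ltW e0)// ler_pdivrMr ?mul1r ?lerDl// ltr_wpDl.
Unshelve. all: by end_near. Qed.

Lemma is_derive_flat n x : is_derive x 1 (flat n) (flat n.+2 x - n%:R * flat n.+1 x).
Proof.
have [x0|x0|->] := ltgtP x 0.
- rewrite !flat_le0 ?ltW// mulr0 subr0.
  apply: (near_eq_is_derive (f := cst 0)); rewrite ?oner_neq0//.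
  by near=> y; rewrite flat_le0//; apply/ltW; near: y; exact: lt_nbhsl.
- pose F (y : R) := y ^- n * expR (- y^-1).
  have xN0 : x != 0 by rewrite gt_eqF.
  have dF : is_derive x 1 F (flat n.+2 x - n%:R * flat n.+1 x).
    have dV : is_derive x (1 : R) (fun y : R => y^-1) (- x ^- 2 *: (1 : R)).
      exact: (is_deriveV xN0 (is_derive_id x 1)).
    have dN : is_derive x (1 : R) (fun y : R => - y^-1) (- (- x ^- 2 *: (1 : R))) := is_deriveN dV.
    have dE := @is_derive1_comp R expR (fun y : R => - y^-1) x _ _ (is_derive_expR _) dN.
    have dX m : is_derive x (1 : R) (fun y : R => y ^- m) (- m%:R * x ^- m.+1).
      case: m => [|m].
        rewrite oppr0 mul0r (_ : (fun y : R => y ^- 0) = cst 1); first exact: is_derive_cst.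
        by apply/funext => y; rewrite expr0 invr1.
      rewrite (_ : (fun y => y ^- m.+1) = (fun y : R => y^-1) ^+ m.+1); last first.
        by apply/funext => y; rewrite -exprVn exprfctE.
      apply: is_derive_eq (is_deriveX m.+1 dV) _.
      by rewrite /GRing.scale /= mulr1 -!exprVn !exprS; ring.
    apply: is_derive_eq (is_deriveM (dX n) dE) _.
    rewrite /flat x0 /GRing.scale /= !mulr1 -!exprVn !exprS.
    by ring.
  apply: near_eq_is_derive dF; rewrite ?oner_neq0//.
  by near=> y; rewrite /flat ifT//; near: y; exact: lt_nbhsr.
- rewrite !flat_le0// mulr0 subr0; apply: (@is_derive0_quadratic _ (n.+2)`!%:R) => y.
  by rewrite ger0_norm ?flat_ge0// flat_quadratic.
Unshelve. all: by end_near. Qed.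

(* A class of functions closed under differentiation, so that a single derivative
   already gives smoothness. *)
Inductive elementary : (R -> R) -> Prop :=
| elementary_flat n : elementary (flat n)
| elementary_cst c : elementary (fun=> c)
| elementary_affine c d f : elementary f -> elementary (fun x => f (c * x + d))
| elementary_add f g : elementary f -> elementary g -> elementary (fun x => f x + g x)
| elementary_mul f g : elementary f -> elementary g -> elementary (fun x => f x * g x)
| elementary_inv f : elementary f -> (forall x, f x != 0) -> elementary (fun x => (f x)^-1).

Lemma elementary_is_derive f : elementary f ->
  exists2 g, elementary g & forall x, is_derive x 1 f (g x).
Proof.
elim=> {f} [n|c|c d f _ [f' ef' df]|f g _ [f' ef' df] _ [g' eg' dg]|
  f g ef [f' ef' df] eg [g' eg' dg]|f ef [f' ef' df] f0].
- exists (fun x => flat n.+2 x + (- n%:R) * flat n.+1 x).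
    apply: elementary_add; first exact: elementary_flat.
    by apply: elementary_mul; [exact: elementary_cst|exact: elementary_flat].
  by move=> x; apply: is_derive_eq (is_derive_flat n x) _; rewrite mulNr.
- by exists (fun=> 0); [exact: elementary_cst|move=> x; exact: is_derive_cst].
- exists (fun x => f' (c * x + d) * c).
    by apply: elementary_mul; [exact: elementary_affine|exact: elementary_cst].
  move=> x; have dl : is_derive x (1 : R) (fun y : R => c * y + d) c.
    by apply: is_derive_eq; rewrite ?addr0 ?mulr1 // /GRing.scale /= ?mulr1 ?mulr0 ?addr0.
  exact: (@is_derive1_comp R f (fun y : R => c * y + d) x _ _ (df (c * x + d)) dl).
- exists (fun x => f' x + g' x); first exact: elementary_add.
  by move=> x; exact: is_deriveD.
- exists (fun x => f x * g' x + g x * f' x).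
    by apply: elementary_add; apply: elementary_mul.
  by move=> x; exact: is_deriveM.
- exists (fun x => (-1 * ((f x)^-1 * (f x)^-1)) * f' x).
    do 2 (apply: elementary_mul => //); first exact: elementary_cst.
    by apply: elementary_mul; apply: elementary_inv.
  move=> x; apply: is_derive_eq (is_deriveV (f0 x) (df x)) _.
  by rewrite /GRing.scale /= mulN1r expr2 invfM.
Qed.

Lemma elementary_derivable f n x : elementary f -> derivable (derive1n n f) x 1.
Proof.
move=> ef; elim: n f ef x => [|n IH] f ef x; have [g eg dg] := elementary_is_derive ef.
  by rewrite derive1n0; exact: ex_derive.
rewrite derive1Sn (_ : f^`() = g); first exact: IH.
by apply/funext => y; rewrite derive1E; apply: derive_val.
Qed.

(** The usual smooth transition from 0 (for x <= 0) to 1 (for x >= 1). The argument 1 - x is spelled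
    in the form that [elementary_affine] produces. *)
Definition smooth_step (x : R) := flat 0 x * (flat 0 x + flat 0 (-1 * x + 1))^-1.

Lemma smooth_step_den_gt0 x : 0 < flat 0 x + flat 0 (-1 * x + 1).
Proof.
have [x0|x0] := ltP 0 x.
  by rewrite ltr_pwDl ?flat_gt0 ?flat_ge0.
by rewrite ltr_wpDl ?flat_ge0// flat_gt0//; lra.
Qed.

Lemma elementary_smooth_step : elementary smooth_step.
Proof.
apply: elementary_mul; first exact: elementary_flat.
apply: (@elementary_inv (fun x => flat 0 x + flat 0 (-1 * x + 1))).
  apply: elementary_add; first exact: elementary_flat.
  by apply: elementary_affine; exact: elementary_flat.
by move=> x; rewrite gt_eqF// smooth_step_den_gt0.
Qed.

Lemma smooth_step_le0 x : x <= 0 -> smooth_step x = 0.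
Proof. by move=> x0; rewrite /smooth_step flat_le0// mul0r. Qed.

Lemma smooth_step_ge1 x : 1 <= x -> smooth_step x = 1.
Proof.
move=> x1; rewrite /smooth_step (@flat_le0 _ (_ + _)); last by lra.
by rewrite addr0 divff// gt_eqF// flat_gt0//; lra.
Qed.

Lemma smooth_step_itv x : 0 <= smooth_step x <= 1.
Proof.
rewrite /smooth_step divr_ge0 ?flat_ge0 ?(ltW (smooth_step_den_gt0 _))//=.
by rewrite ler_pdivrMr ?smooth_step_den_gt0// mul1r lerDl flat_ge0.
Qed.

End smooth_step.

Lemma Rintegral_dominated d (T : measurableType d) (R : realType)
    (mu : {measure set T -> \bar R}) (D : set T) (f_ : nat -> T -> R) (f G : T -> R) :
  measurable D -> (forall n, measurable_fun D (f_ n)) ->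
  (forall x, D x -> f_ n x @[n --> \oo] --> f x) ->
  mu.-integrable D (EFin \o G) -> (forall n x, D x -> `|f_ n x| <= G x) ->
  (\int[mu]_(x in D) f_ n x)%R @[n --> \oo] --> (\int[mu]_(x in D) f x)%R.
Proof.
move=> mD mf_ f_f iG f_G.
have mf : measurable_fun D f by exact: (measurable_fun_cvg mf_ f_f).
have := @dominated_convergence _ _ _ mu D mD (fun n => EFin \o f_ n) (EFin \o f) (EFin \o G).
case=> [n|||||fi _ cv].
- exact/measurable_EFinP.
- exact/measurable_EFinP.
- by apply: aeW => x Dx; apply: cvg_EFin; [exact: nearW|exact: f_f].
- exact: iG.
- by apply: aeW => x n Dx; rewrite /= lee_fin f_G.
apply: fine_cvg; rewrite /Rintegral fineK; last exact: integrable_fin_num.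
exact: cv.
Qed.

(** * One-sided mollifiers and Lebesgue points *)

Section mollifier.
Context (R : realType).
Notation mu := (@lebesgue_measure R).
Notation L1R f := (mu.-integrable [set: R] (EFin \o f)).
Notation S := (@smooth_step R).
Notation S' := (derive1 (@smooth_step R)).

Lemma elementary_derive1 (f : R -> R) : elementary f -> elementary (derive1 f).
Proof.
move=> ef; have [g eg dg] := elementary_is_derive ef.
rewrite (_ : derive1 f = g)//; apply/funext => y; rewrite derive1E.
exact: derive_val.
Qed.

Lemma elementary_continuous (f : R -> R) : elementary f -> continuous f.
Proof.
move=> ef x; apply/differentiable_continuous/derivable1_diffP.
by have := @elementary_derivable R f 0%N x ef; rewrite derive1n0.
Qed.

Lemma derive1_smooth_step_out x : x < 0 \/ 1 < x -> S' x = 0.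
Proof.
move=> x01; have [c Sc] : exists c, \near x, cst c x = S x.
  case: x01 => x01.
    by exists 0; near=> y; rewrite smooth_step_le0//; apply/ltW; near: y; exact: lt_nbhsl.
  by exists 1; near=> y; rewrite smooth_step_ge1//; apply/ltW; near: y; exact: lt_nbhsr.
have d0 : is_derive x (1 : R) (S : R -> R) 0.
  by apply: near_eq_is_derive Sc _; exact: is_derive_cst.
by rewrite derive1E; exact: derive_val.
Unshelve. all: by end_near. Qed.

Lemma derive1_smooth_step_bounded : exists2 C : R, 0 < C & forall x, `|S' x| <= C.
Proof.
have cS' : continuous S' by exact/elementary_continuous/elementary_derive1/elementary_smooth_step.
have cnS' : continuous (fun x => `|S' x|) by move=> x; apply: cvg_norm; exact: cS'.
have [c _ cmax] := @EVT_max R (fun x => `|S' x|) 0 1 ler01 (continuous_subspaceT cnS').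
exists (`|S' c| + 1) => [|x]; first by rewrite ltr_wpDl.
have [x01|] := boolP (x \in `[0, 1]%R); first by rewrite (le_trans (cmax _ x01))// lerDl.
rewrite in_itv/= negb_and -!ltNge => /orP x01.
by rewrite derive1_smooth_step_out// normr0 addr_ge0.
Qed.

(** The derivative of the step rescaled to [x, x + 1/(n+1)]: a bump of integral 1 lying to the right
    of [x]. *)
Definition mollifier (n : nat) (x t : R) : R := n.+1%:R * S' (n.+1%:R * (t - x)).

Lemma is_derive_scaled_step n x t :
  is_derive t (1 : R) (fun t => S (n.+1%:R * (t - x))) (mollifier n x t).
Proof.
have dl : is_derive t (1 : R) (fun y : R => n.+1%:R * (y - x)) n.+1%:R.
  by apply: is_derive_eq; rewrite /GRing.scale /= ?mulr1 ?mulr0 ?addr0 ?subr0 ?mulr1.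
have [g eg dg] := elementary_is_derive (elementary_smooth_step R).
have dS : is_derive (n.+1%:R * (t - x)) (1 : R) S (S' (n.+1%:R * (t - x))).
  by rewrite derive1E; apply: DeriveDef => //; exact: ex_derive.
apply: is_derive_eq (@is_derive1_comp R S (fun y : R => n.+1%:R * (y - x)) t _ _ dS dl) _.
by rewrite mulrC.
Qed.

Lemma continuous_mollifier n x : continuous (mollifier n x).
Proof.
apply: elementary_continuous.
rewrite (_ : mollifier n x = fun t => n.+1%:R * S' (n.+1%:R * t + - (n.+1%:R * x))).
  apply: (elementary_mul (elementary_cst _)); apply: elementary_affine.
  exact/elementary_derive1/elementary_smooth_step.
by apply/funext => t; rewrite /mollifier mulrBr.
Qed.

Lemma mollifier_out n x t : t \notin `[x, x + n.+1%:R^-1]%R -> mollifier n x t = 0.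
Proof.
rewrite in_itv/= negb_and -!ltNge => tx; rewrite /mollifier derive1_smooth_step_out ?mulr0//.
have n0 : (0 : R) < n.+1%:R by rewrite ltr0n.
case/orP: tx => tx; [left|right].
  by rewrite pmulr_rlt0// subr_lt0.
by rewrite -ltr_pdivrMl// mulr1 ltrBrDl.
Qed.

Lemma Rintegral_mollifier n x :
  \int[mu]_(t in `[x, x + n.+1%:R^-1]) mollifier n x t = 1.
Proof.
have n0 : (0 : R) < n.+1%:R^-1 by rewrite invr_gt0 ltr0n.
have dd (t : R) : derivable (fun t => S (n.+1%:R * (t - x)) : R) t 1.
  by case: (is_derive_scaled_step n x t).
have cc : continuous (fun t => S (n.+1%:R * (t - x)) : R).
  by move=> t; exact/differentiable_continuous/derivable1_diffP.
rewrite /Rintegral (@continuous_FTC2 R _ (fun t => S (n.+1%:R * (t - x)))).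
- rewrite subrr mulr0 (@smooth_step_le0 _ 0)// smooth_step_ge1 ?sube0//.
  by rewrite (_ : x + n.+1%:R^-1 - x = n.+1%:R^-1) ?divff ?pnatr_eq0//; ring.
- by rewrite ltrDl.
- exact/continuous_subspaceT/continuous_mollifier.
- split; [by move=> t _|exact/cvg_at_right_filter/cc|exact/cvg_at_left_filter/cc].
- by move=> t _; rewrite derive1E; case: (is_derive_scaled_step n x t).
Qed.

Lemma Rintegral_support (D E : set R) (f : R -> R) : E `<=` D ->
  (forall t, D t -> ~ E t -> f t = 0) ->
  \int[mu]_(t in D) f t = \int[mu]_(t in E) f t.
Proof.
move=> ED f0; rewrite Rintegral_mkcond [RHS]Rintegral_mkcond; congr Rintegral.
apply/funext => t; rewrite !patchE.
have [Dt|nDt] := boolP (t \in D); have [Et|nEt] := boolP (t \in E) => //.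
- by rewrite f0//; [exact/set_mem|move/mem_set; exact/negP].
- by move: nDt; rewrite notin_setE => nDt; case: nDt; apply: ED; exact/set_mem.
Qed.

Lemma lebesgue_pt_right (F : R -> R) (x : R) : L1R F -> lebesgue_pt F x ->
  forall e : R, 0 < e -> \forall n \near \oo,
    \int[mu]_(t in `[x, x + n.+1%:R^-1]) `|F t - F x| <= e * n.+1%:R^-1.
Proof.
move=> Fi /fine_cvgP[ff] /cvgrPdist_lt fx e e0.
(* The interval [x, x + 1/(n+1)] is closed, so it is put in the open ball of radius [r] = 2/(n+1),
   whose measure is 4/(n+1); hence the factor 4. *)
have e40 : 0 < e / 4 by rewrite divr_gt0.
have [d /= d0 Hd] := filterI ff (fx _ e40).
have dn : 0 < d / 2 by rewrite divr_gt0.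
near=> n; have n0 : (0 : R) < n.+1%:R^-1 by rewrite invr_gt0 ltr0n.
pose r := n.+1%:R^-1 * 2 : R; have r0 : 0 < r by rewrite mulr_gt0.
have rd : r < d.
  rewrite -ltr_pdivlMr//; near: n; exact: (near_infty_natSinv_lt (PosNum dn)).
have [|rfin] := Hd r _ r0; first by rewrite /ball /= sub0r normrN gtr0_norm.
rewrite sub0r normrN ger0_norm ?fine_ge0 ?davg_ge0// => re.
have mFx : measurable_fun setT (fun t => F t - F x).
  by apply: measurable_funB => //; exact: measurable_L1R.
have : (\int[mu]_(t in ball x r) `|(F t - F x)%:E| < (e * n.+1%:R^-1)%:E)%E.
  move: re; rewrite -lte_fin fineK// /davg /iavg lebesgue_measure_ball ?ltW//.
  rewrite inver gt_eqF ?pmulrn_lgt0// lte_pdivrMl ?pmulrn_lgt0// -EFinM.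
  by congr (_ < _)%E; rewrite /r -mulr_natr; congr EFin; field; rewrite ?pnatr_eq0.
move=> He.
have Hle : (\int[mu]_(t in `[x, (x + n.+1%:R^-1)%R]) `|(F t - F x)%:E| <=
    \int[mu]_(t in ball x r) `|(F t - F x)%:E|)%E.
  apply: ge0_subset_integral => //=.
  - exact: measurable_ball.
  - by apply/measurable_funTS/measurable_EFinP; exact: measurableT_comp.
  - move=> t /=; rewrite in_itv/= => /andP[xt tx]; rewrite /ball /= ler0_norm ?subr_le0//.
    by rewrite /r; move: (_^-1) n0 xt tx => q; lra.
rewrite -lee_fin /Rintegral fineK; first exact: le_trans Hle (ltW He).
rewrite ge0_fin_numE; last by apply: integral_ge0 => t _; rewrite lee_fin.
exact: le_lt_trans Hle (lt_trans He (ltry _)).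
Unshelve. all: by end_near. Qed.

Lemma bounded_itv_integrable (a b M : R) (h : R -> R) : measurable_fun setT h ->
  (forall t, `|h t| <= M) -> mu.-integrable `[a, b] (EFin \o h).
Proof.
move=> mh hM.
have muoo : (mu `[a, b]%classic < +oo)%E.
  by rewrite lebesgue_measure_itv/=; case: ifP => _; rewrite ?ltry// -EFinB ltry.
apply: (measurable_bounded_integrable _ muoo).
- exact: measurable_itv.
- exact: measurable_funTS.
- exists M; split; first by rewrite num_real.
  by move=> N MN t _; apply: le_trans (hM t) (ltW MN).
Qed.

(** The mollifier has integral 1 and is at most (n+1) C on an interval of length 1/(n+1). The error
    is thus at most [C] times the mean of |F - F x| on that interval, which tends to 0 at a Lebesgue
    point. *)
Lemma cvg_mollify (F : R -> R) (D : set R) (x : R) : L1R F -> lebesgue_pt F x ->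
  (\forall n \near \oo, `[x, x + n.+1%:R^-1] `<=` D) ->
  (\int[mu]_(t in D) (F t * mollifier n x t))%R @[n --> \oo] --> F x.
Proof.
move=> Fi Fx HD; have [C C0 S'C] := derive1_smooth_step_bounded.
apply/cvgrPdist_le => e e0; have eC : 0 < e / C by rewrite divr_gt0.
near=> n; have ID : `[x, x + n.+1%:R^-1] `<=` D by near: n.
have He : \int[mu]_(t in `[x, x + n.+1%:R^-1]) `|F t - F x| <= e / C * n.+1%:R^-1.
  by near: n; exact: lebesgue_pt_right.
rewrite (Rintegral_support ID); last first.
  move=> t _ nt; rewrite mollifier_out ?mulr0//; exact/negP.
have mF := measurable_L1R Fi.
have mI : measurable (`[x, x + n.+1%:R^-1]%classic : set (measurableTypeR R)) by exact: measurable_itv.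
have mm : measurable_fun setT (mollifier n x).
  by apply: continuous_measurable_fun; exact: continuous_mollifier.
have mC t : `|mollifier n x t| <= n.+1%:R * C.
  by rewrite /mollifier normrM ger0_norm// ler_wpM2l.
have mi : mu.-integrable `[x, x + n.+1%:R^-1] (EFin \o mollifier n x).
  exact: bounded_itv_integrable mC.
have FI : mu.-integrable `[x, x + n.+1%:R^-1] (EFin \o F).
  have Fi' := Fi; by apply: integrableS Fi'.
have bdd (h : R -> R) : mu.-integrable `[x, x + n.+1%:R^-1] (EFin \o h) ->
    mu.-integrable `[x, x + n.+1%:R^-1] (EFin \o (fun t => h t * mollifier n x t)).
  move=> hi; apply: (integrableM_bounded (M := n.+1%:R * C)) => //.
  exact: measurable_funTS.
have FxE : F x = \int[mu]_(t in `[x, x + n.+1%:R^-1]) (F x * mollifier n x t).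
  by rewrite RintegralZl// Rintegral_mollifier mulr1.
rewrite {1}FxE -RintegralB//; last 2 first.
- by have := integrableZl mI (F x) mi; apply: eq_integrable.
- exact: bdd.
have ci : mu.-integrable `[x, x + n.+1%:R^-1] (EFin \o (fun=> F x)).
  exact: (@bounded_itv_integrable _ _ `|F x|).
have FFi : mu.-integrable `[x, x + n.+1%:R^-1] (EFin \o (fun t => F x - F t)).
  by have := integrableB mI ci FI; apply: eq_integrable => // t _; rewrite /= EFinB.
have FFmi : mu.-integrable `[x, x + n.+1%:R^-1] (EFin \o (fun t => (F x - F t) * mollifier n x t)).
  exact: bdd.
under eq_Rintegral do rewrite -mulrBl.
apply: (le_trans (le_normr_Rintegral mI FFmi)).
apply: (@le_trans _ _ (\int[mu]_(t in `[x, x + n.+1%:R^-1]) (n.+1%:R * C * `|F t - F x|))).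
  apply: le_Rintegral => //.
  - exact: (integrable_abse FFmi).
  - have := integrableZl mI (n.+1%:R * C) (integrable_abse FFi); apply: eq_integrable => // t _.
    by rewrite /= -EFinM distrC.
  - by move=> t _; rewrite normrM mulrC distrC ler_wpM2r.
rewrite RintegralZl//; last first.
  by have := integrable_abse FFi; apply: eq_integrable => // t _; rewrite /= distrC.
have n0 : (0 : R) < n.+1%:R by rewrite ltr0n.
apply: (@le_trans _ _ (n.+1%:R * C * (e / C * n.+1%:R^-1))); first by apply: ler_wpM2l => //; rewrite mulr_ge0// ltW.
by rewrite le_eqVlt; apply/orP; left; apply/eqP; field; rewrite !gt_eqF.
Unshelve. all: by end_near. Qed.

End mollifier.

Section du_bois_reymond.
Context (R : realType).
Notation mu := (@lebesgue_measure R).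
Notation L1R f := (mu.-integrable [set: R] (EFin \o f)).
Notation S := (@smooth_step R).

Definition plateau (n : nat) (x y t : R) : R :=
  S (n.+1%:R * (t - x)) - S (n.+1%:R * (t - y)).

Lemma elementary_plateau n x y : elementary (plateau n x y).
Proof.
rewrite (_ : plateau n x y = fun t => S (n.+1%:R * t + - (n.+1%:R * x)) +
    (-1) * S (n.+1%:R * t + - (n.+1%:R * y))); last first.
  by apply/funext => t; rewrite /plateau !mulrBr mulN1r.
apply: elementary_add; last apply: (elementary_mul (elementary_cst _)).
  exact/elementary_affine/elementary_smooth_step.
exact/elementary_affine/elementary_smooth_step.
Qed.

Lemma derive1_plateau n x y t :
  derive1 (plateau n x y) t = mollifier n x t - mollifier n y t.
Proof.
rewrite derive1E; have := is_deriveB (is_derive_scaled_step n x t) (is_derive_scaled_step n y t).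
by case.
Qed.

Lemma plateau_out n x y t : x <= y -> t \notin `[x, y + n.+1%:R^-1]%R ->
  plateau n x y t = 0.
Proof.
move=> xy; have n0 : (0 : R) < n.+1%:R by rewrite ltr0n.
rewrite in_itv/= negb_and -!ltNge => /orP[tx|ty]; rewrite /plateau.
  by rewrite !smooth_step_le0 ?subr0// pmulr_rle0// subr_le0; lra.
have tyn : n.+1%:R^-1 <= t - y by rewrite lerBrDl ltW.
have H (z : R) : n.+1%:R^-1 <= z -> 1 <= n.+1%:R * z.
  by move=> /(ler_wpM2l (ltW n0)); rewrite divff ?gt_eqF.
rewrite (smooth_step_ge1 (H _ tyn)) smooth_step_ge1 ?subrr//; apply/H/(le_trans tyn).
by rewrite lerD2l lerN2.
Qed.

Lemma plateau_norm n x y t : `|plateau n x y t| <= 1.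
Proof.
have /andP[? ?] := smooth_step_itv (n.+1%:R * (t - x)).
have /andP[? ?] := smooth_step_itv (n.+1%:R * (t - y)).
by rewrite /plateau ler_norml; lra.
Qed.

Lemma cvg_step (x t : R) :
  (S (n.+1%:R * (t - x)) : R) @[n --> \oo] --> ((x < t)%R%:R : R).
Proof.
have [xt|tx] := ltP x t; last first.
  apply: cvg_near_cst; apply: nearW => n; rewrite smooth_step_le0//.
  by rewrite pmulr_rle0 ?ltr0n// subr_le0.
have tx0 : 0 < t - x by rewrite subr_gt0.
apply: cvg_near_cst; near=> n; rewrite smooth_step_ge1//.
rewrite -ler_pdivrMl ?ltr0n// mulr1; apply: ltW.
near: n; exact: (near_infty_natSinv_lt (PosNum tx0)).
Unshelve. all: by end_near. Qed.

Lemma test_function_plateau (b x y : R) n : 0 < x -> x <= y -> y + n.+1%:R^-1 < b ->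
  test_function b (plateau n x y).
Proof.
move=> x0 xy yb; split; first by move=> m t; apply: elementary_derivable; exact: elementary_plateau.
exists `[x, y + n.+1%:R^-1]%classic; first split.
- exact: segment_compact.
- by move=> t /=; rewrite !in_itv/= => /andP[xt ty]; apply/andP; split; [exact: lt_le_trans xt|exact: le_lt_trans yb].
- by move=> t /negP nt; exact: plateau_out.
Qed.

(* The test functions are smooth plateaus approximating the indicator of ]x, y];
   their derivative is a difference of mollifiers concentrated at x and at y. *)
Lemma weak_derivative_lebesgue_pt (b : R) (F h : R -> R) (x y : R) :
  L1R F -> L1R h ->
  (forall phi, test_function b phi ->
    \int[mu]_(t in `]0, b[) (F t * derive1 phi t) = - \int[mu]_(t in `]0, b[) (h t * phi t)) ->
  0 < x -> x < y -> y < b -> lebesgue_pt F x -> lebesgue_pt F y ->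
  F y - F x = \int[mu]_(t in `]x, y]) h t.
Proof.
move=> Fi hi Fh x0 xy yb Fx Fy.
have mD : measurable (`]0, b[%classic : set (measurableTypeR R)) by exact: measurable_itv.
have sub (z : R) : 0 < z -> z < b ->
    \forall n \near \oo, `[z, z + n.+1%:R^-1] `<=` `]0, b[.
  move=> z0 zb; have bz : 0 < b - z by rewrite subr_gt0.
  near=> n; have : n.+1%:R^-1 < b - z by near: n; exact: (near_infty_natSinv_lt (PosNum bz)).
  move: (_^-1) => q nbz t /=; rewrite !in_itv/= => /andP[zt tz]; apply/andP; split; lra.
have limL : (\int[mu]_(t in `]0, b[) (F t * derive1 (plateau n x y) t))%R @[n --> \oo]
    --> F x - F y.
  rewrite (_ : (fun n => _) = (fun n => \int[mu]_(t in `]0, b[) (F t * mollifier n x t) -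
     \int[mu]_(t in `]0, b[) (F t * mollifier n y t))).
    apply: cvgB; apply: cvg_mollify => //; apply: sub; lra.
  have [C C0 S'C] := derive1_smooth_step_bounded R.
  have Fm n z : mu.-integrable `]0, b[ (EFin \o (fun t => F t * mollifier n z t)).
    apply: (integrableM_bounded (M := n.+1%:R * C)) => //.
    - by apply: integrableS Fi.
    - apply: measurable_funTS; apply: continuous_measurable_fun; exact: continuous_mollifier.
    - by move=> t _; rewrite /mollifier normrM ger0_norm// ler_wpM2l.
  apply/funext => n; rewrite -RintegralB//; apply: eq_Rintegral => t _.
  by rewrite derive1_plateau mulrBr.
have limR : (\int[mu]_(t in `]0, b[) (h t * plateau n x y t))%R @[n --> \oo]
    --> (\int[mu]_(t in `]x, y]) h t)%R.
  have -> : \int[mu]_(t in `]x, y]) h t = \int[mu]_(t in `]0, b[) (h t * ((x < t)%R%:R - (y < t)%R%:R)).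
    rewrite [RHS](@Rintegral_support _ _ `]x, y]).
    - apply: eq_Rintegral => t; rewrite inE /= in_itv/= => /andP[-> ty].
      by rewrite ltNge ty subr0 mulr1.
    - by move=> t /=; rewrite !in_itv/= => /andP[xt ty]; apply/andP; split; lra.
    - move=> t _ /negP; rewrite /= in_itv/= negb_and -leNgt -ltNge => /orP[tx|yt].
        by rewrite ltNge tx ltNge (le_trans tx (ltW xy)) subr0 mulr0.
      by rewrite yt (lt_trans xy yt) subrr mulr0.
  have mh := measurable_L1R hi.
  apply: (@Rintegral_dominated _ _ _ mu _ _ _ (fun t => `|h t|)) => //.
  - move=> n; apply: measurable_funM; first exact: measurable_funTS.
    apply: measurable_funTS; apply: continuous_measurable_fun.
    exact/elementary_continuous/elementary_plateau.
  - by move=> t _; apply: cvgMr; apply: (cvgB (@cvg_step x t) (@cvg_step y t)).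
  - by have := integrable_abse hi; apply: integrableS.
  - by move=> n t _; rewrite normrM ler_piMr// plateau_norm.
have : F x - F y = - \int[mu]_(t in `]x, y]) h t.
  rewrite -(cvg_lim _ limL)//; apply: cvg_lim => //.
  apply: cvg_trans (cvgN limR); apply: near_eq_cvg.
  have by0 : 0 < b - y by rewrite subr_gt0.
  near=> n; rewrite /= Fh//; apply: test_function_plateau => //; first exact: ltW.
  have : n.+1%:R^-1 < b - y by near: n; exact: (near_infty_natSinv_lt (PosNum by0)).
  by move: (_^-1) => q ?; lra.
by move=> E; rewrite -opprB E opprK.
Unshelve. all: by end_near. Qed.

End du_bois_reymond.

(** * A Borel version of the partial derivative *)

Section lebesgue_points_of_sections.
Context (R : realType).
Notation mu := (@lebesgue_measure R).
Notation L1R f := (mu.-integrable [set: R] (EFin \o f)).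

Lemma davgE (f : R -> R) (x r : R) : 0 < r ->
  davg f x r = ((2 * r)^-1%:E * \int[mu]_(y in ball x r) `|(f y - f x)%:E|)%E.
Proof.
move=> r0; rewrite /davg /iavg lebesgue_measure_ball ?ltW// inver.
by rewrite gt_eqF ?pmulrn_lgt0// mulr_natl.
Qed.

Lemma cvg_davg_harmonic (f : R -> R) (x : R) : lebesgue_pt f x ->
  davg f x n.+1%:R^-1 @[n --> \oo] --> 0%E.
Proof.
apply: cvg_comp => P [d /= d0 dP]; near=> n; apply: dP.
  rewrite /ball /= sub0r normrN ger0_norm ?invr_ge0//.
  by near: n; exact: (near_infty_natSinv_lt (PosNum d0)).
by rewrite /= invr_gt0.
Unshelve. all: by end_near. Qed.

(** For small [r], let n+1 be the integer part of 1/r. Then r <= 1/(n+1) <= 2r, so passing from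
    radius [r] to radius 1/(n+1) costs at most a factor 2 in the average. Countably many radii thus
    detect Lebesgue points. *)
Lemma lebesgue_pt_harmonic (f : R -> R) (x : R) : measurable_fun setT f ->
  davg f x n.+1%:R^-1 @[n --> \oo] --> 0%E -> lebesgue_pt f x.
Proof.
move=> mf /fine_cvgP[[N1 _ ff] /cvgrPdist_lt fx].
have key e : 0 < e -> exists2 d : R, 0 < d & forall r, 0 < r -> r < d -> (davg f x r <= e%:E)%E.
  move=> e0; have e20 : 0 < e / 2 by rewrite divr_gt0.
  have [N2 _ HN] := fx _ e20.
  exists ((maxn N1 N2).+1%:R^-1); first by rewrite invr_gt0.
  move=> r r0 rN; have rV : 0 <= r^-1 by rewrite invr_ge0 ltW.
  have Nr : (maxn N1 N2).+1%:R <= r^-1.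
    by rewrite -[leLHS]invrK lef_pV2 ?posrE ?invr_gt0// ltW.
  have := truncn_itv rV; case E : (Num.truncn r^-1) => [|n] /andP[nr rn].
    by move: Nr; rewrite -truncn_ge_nat// E.
  have Nn : (maxn N1 N2 <= n)%N by rewrite -ltnS -E truncn_ge_nat.
  have n0 : (0 : R) < n.+1%:R by rewrite ltr0n.
  have rn1 : r <= n.+1%:R^-1 by rewrite -[leLHS]invrK lef_pV2 ?posrE ?invr_gt0.
  have := HN n (leq_trans (leq_maxr _ _) Nn); rewrite sub0r normrN /=.
  rewrite ger0_norm ?fine_ge0 ?davg_ge0// -lte_fin fineK; last first.
    by apply: ff; exact: leq_trans (leq_maxl _ _) Nn.
  rewrite !davgE ?invr_gt0// lte_pdivrMl ?mulr_gt0 ?invr_gt0// => He.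
  rewrite lee_pdivrMl ?mulr_gt0//.
  apply: (@le_trans _ _ (\int[mu]_(y in ball x n.+1%:R^-1) `|(f y - f x)%:E|)%E).
    apply: ge0_subset_integral => //=.
    - exact: measurable_ball.
    - exact: measurable_ball.
    - by apply/measurable_funTS/measurable_EFinP; apply: measurableT_comp => //; exact: measurable_funB.
    - exact: le_ball.
  apply: (le_trans (ltW He)); rewrite -EFinM lee_fin.
  have rn2 : n.+1%:R^-1 <= 2 * r.
    rewrite -[2 * r]invrK lef_pV2 ?posrE ?invr_gt0 ?mulr_gt0// invfM.
    rewrite mulrC ler_pdivrMr//; apply: (le_trans (ltW rn)).
    by rewrite -natrM ler_nat; lia.
  rewrite (_ : 2 * n.+1%:R^-1 * (e / 2) = n.+1%:R^-1 * e); first by rewrite ler_wpM2r// ltW.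
  by field; rewrite gt_eqF.
have {}key (e : R) : 0 < e -> \forall r \near 0^'+, (davg f x r <= e%:E)%E.
  move=> e0; have [d d0 Hd] := key e e0; exists d => // r; rewrite /= sub0r normrN => rd r0.
  by apply: Hd => //; exact: le_lt_trans (ler_norm _) rd.
apply/fine_cvgP; split.
  apply: filterS (key 1 ltr01) => r Hr.
  by rewrite ge0_fin_numE ?davg_ge0//; exact: le_lt_trans Hr (ltry 1).
apply/cvgrPdist_le => e e0; apply: filterS (key e e0) => r Hr.
rewrite sub0r normrN ger0_norm ?fine_ge0 ?davg_ge0// -lee_fin fineK//.
by rewrite ge0_fin_numE ?davg_ge0//; exact: le_lt_trans Hr (ltry _).
Qed.

(** The pairs whose second component is a Lebesgue point of the section of [N] at the first. A
    limsup along a sequence of radii exists at every point and makes the set Borel in the plane. *)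
Definition lebesgue_sections (N : R * R -> R) : set (R * R) :=
  [set p | (limn_esup (fun n => davg (fun y => N (p.1, y)) p.2 n.+1%:R^-1) <= 0)%E].

Lemma measurable_lebesgue_sections (N : R * R -> R) : measurable_fun setT N ->
  measurable (lebesgue_sections N).
Proof.
move=> mN; rewrite -[X in measurable X]setTI.
have mdavg n : measurable_fun setT (fun p : R * R => davg (fun y => N (p.1, y)) p.2 n.+1%:R^-1).
  have n0 : (0 : R) < n.+1%:R^-1 by rewrite invr_gt0.
  under eq_fun do rewrite davgE//.
  apply: emeasurable_funM => //.
  (* Writing the ball as an indicator turns the integral into a section integral of a Borel function
     of three variables, measurable by Tonelli. *)
  pose H (q : (R * R) * R) : \bar R :=
    (`|(N (q.1.1, q.2) - N (q.1.1, q.1.2)) * (`|q.1.2 - q.2| < n.+1%:R^-1)%R%:R|)%:E.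
  rewrite (_ : (fun p => _) = (fun p => \int[mu]_y H (p, y))%E).
    have mH : measurable_fun setT H.
      apply/measurable_EFinP; apply: measurableT_comp => //; apply: measurable_funM.
        apply: measurable_funB; apply: (measurableT_comp mN); apply: measurable_fun_pair => //=;
        by do ?[exact: measurable_fst|exact: measurable_snd|apply: measurableT_comp].
      apply: measurable_fun_natr_bool; apply: measurable_fun_ltr => //.
      by apply: measurableT_comp => //; apply: measurable_funB => //; apply: measurableT_comp.
    by apply: (@measurable_fun_fubini_tonelli_F _ _ _ _ _ mu H mH) => q; rewrite lee_fin.
  apply/funext => p; rewrite integral_mkcond; apply: eq_integral => y _.
  rewrite patchE /H /=; case: ifPn => [/set_mem|/negP].
    by rewrite /ball /= => ->; rewrite mulr1.
  move=> nb; rewrite (_ : (_ < _) = false) ?mulr0 ?normr0//.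
  by apply/negP => b; apply: nb; apply/mem_set.
rewrite (_ : lebesgue_sections N = (fun p : R * R => limn_esup
    (fun n => davg (fun y => N (p.1, y)) p.2 n.+1%:R^-1)) @^-1` `]-oo, 0%E]).
  exact: (measurable_fun_limn_esup mdavg measurableT (emeasurable_itv _)).
by apply/seteqP; split=> p; rewrite /lebesgue_sections /= in_itv.
Qed.

Lemma lebesgue_sectionsP (N : R * R -> R) (s x : R) :
  measurable_fun setT (fun y => N (s, y)) ->
  lebesgue_sections N (s, x) <-> lebesgue_pt (fun y => N (s, y)) x.
Proof.
move=> mN; split => [Nx|/cvg_davg_harmonic Nx].
  apply: lebesgue_pt_harmonic => //; apply: limn_esup_le_cvg => // n.
  exact: davg_ge0.
by rewrite /lebesgue_sections /= is_cvg_limn_esupE ?(cvg_lim _ Nx)//; apply/cvg_ex; exists 0%E.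
Qed.

End lebesgue_points_of_sections.

Section section_derivative.
Context (R : realType).
Notation mu := (@lebesgue_measure R).
Notation L1R f := (mu.-integrable [set: R] (EFin \o f)).

Lemma ae_neq (c : R) : {ae mu, forall x, x != c}.
Proof.
exists [set c]; split; [exact: measurable_set1|exact: lebesgue_measure_set1|].
by move=> x /= /negP; rewrite negbK => /eqP.
Qed.

Lemma cvg_diff_quotient (F : R -> R) (x : R) : derivable F x 1 ->
  n.+1%:R * (F (x + n.+1%:R^-1) - F x) @[n --> \oo] --> derive1 F x.
Proof.
move=> dF; have := dF; rewrite derive1E /derive /derivable => cF.
have hn : (fun n : nat => n.+1%:R^-1 : R) @ \oo --> (0 : R)^'.
  move=> A [d /= d0 dA]; suff : \forall n \near \oo, A n.+1%:R^-1 by [].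
  near=> n; have n0 : (0 : R) < n.+1%:R^-1 by rewrite invr_gt0.
  apply: dA; last exact: lt0r_neq0.
  rewrite /ball_ /= sub0r normrN gtr0_norm//.
  by near: n; exact: (near_infty_natSinv_lt (PosNum d0)).
have := cvg_comp _ _ hn cF; apply: cvg_trans; apply: near_eq_cvg; near=> n.
by rewrite /GRing.scale /= invrK mulr1 [_ + x]addrC.
Unshelve. all: by end_near. Qed.

Lemma L1R_dominated (f c : R -> R) : measurable_fun setT f -> L1R c ->
  (forall x, `|f x| <= `|c x|) -> L1R f.
Proof.
move=> mf ci fc; have := ci; apply: le_integrable => //.
  exact/measurable_EFinP.
by move=> x _; rewrite /= lee_fin.
Qed.

(* Nothing guarantees that (s, x) |-> derive1 (g s) x is jointly measurable.  The
   Borel function N built from difference quotients replaces it: its Lebesgue points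
   along the sections form a Borel set of full measure, at which g s is derivable
   with derivative N (s, x). *)
Lemma section_derivative_version (b : R) (g : R -> R -> R) (gbar : R -> R)
    (P : R * R -> R) :
  L1R gbar -> measurable_fun setT P ->
  (forall s, 0 <= s <= b -> absolutely_continuous_on 0 (b - s) (g s)) ->
  (forall s, 0 <= s <= b -> {ae mu, forall x, 0 < x < b - s ->
    `|derive1 (g s) x| <= gbar x}) ->
  {ae mu, forall s, 0 < s < b -> {ae mu, forall x, 0 < x < b - s -> g s x = P (s, x)}} ->
  exists (N : R * R -> R) (c : R -> R), [/\ measurable_fun setT N, measurable_fun setT c,
    forall s x, `|N (s, x)| <= `|gbar x|,
    {ae mu, forall s, 0 < s < b -> c s = g s 0 /\
      forall x, 0 <= x <= b - s -> g s x = g s 0 + \int[mu]_(y in `]0, x]) N (s, y)} &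
    {ae mu, forall t, 0 < t < b -> {ae mu, forall s, 0 < s < t ->
      derive1 (g s) (t - s) = N (s, t - s)}}].
Proof.
move=> gbi mP gAC gb gP; have mgb := measurable_L1R gbi.
pose D n (p : R * R) := n.+1%:R * (P (p.1, p.2 + n.+1%:R^-1) - P p).
(* The limsup is Borel and defined everywhere; it is the derivative wherever the quotients converge
   to it. The clamp in [N] then makes the bound by [gbar] hold at every point. *)
pose N0 (p : R * R) := fine (limn_esup (fun n => (D n p)%:E)).
pose N (p : R * R) := Num.max (- `|gbar p.2|) (Num.min `|gbar p.2| (N0 p)).
have mgb2 : measurable_fun setT (fun p : R * R => `|gbar p.2|).
  by apply: measurableT_comp => //; exact: measurableT_comp.
have mN0 : measurable_fun setT N0.
  apply: (measurableT_comp (fine_measurable measurableT)).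
  apply: measurable_fun_limn_esup => n; apply/measurable_EFinP.
  apply: measurable_funM => //; apply: measurable_funB => //.
  apply: (measurableT_comp mP); apply: measurable_fun_pair => //=.
  exact: measurable_funD.
have mN : measurable_fun setT N.
  apply: measurable_maxr; first exact: measurableT_comp.
  exact: measurable_minr.
have Nle s x : `|N (s, x)| <= `|gbar x|.
  rewrite /N /= ler_norml le_max lexx /= ge_max; apply/andP; split.
    by rewrite (@le_trans _ _ 0)// oppr_le0.
  by rewrite ge_min lexx.
have mNs s : measurable_fun setT (fun y => N (s, y)).
  exact: measurableT_comp mN (pair1_measurable s).
have Ni s : L1R (fun y => N (s, y)) by exact: (L1R_dominated (mNs s) gbi (Nle s)).
(* The trace [g s 0] is a value at a single point, which almost everywhere equality with [P] does
   not reach. For almost every [s] the difference below equals [g s 0] at almost every x of ]0, b -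
   s[, and [c s] is its mean there, hence measurable in [s]. *)
pose c s := (b - s) `^ (-1) * \int[mu]_x ((0 < x < b - s)%R%:R *
  (P (s, x) - \int[mu]_y ((0 < y <= x)%R%:R * N (s, y)))).
have mc : measurable_fun setT c.
  have mX : measurable_fun setT (fun p : R * R => \int[mu]_y ((0 < y <= p.2)%R%:R * N (p.1, y))).
    apply: (@measurable_Rintegral1 _ _ _ _ _ mu (fun q : (R * R) * R =>
      (0 < q.2 <= q.1.2)%R%:R * N (q.1.1, q.2))).
    apply: measurable_funM.
      apply: measurable_fun_natr_bool; apply: measurable_and.
        by apply: measurable_fun_ltr.
      by apply: measurable_fun_ler => //; apply: measurableT_comp.
    by apply: (measurableT_comp mN); apply: measurable_fun_pair => //=; apply: measurableT_comp.
  apply: measurable_funM; last first.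
    apply: (@measurable_Rintegral1 _ _ _ _ _ mu (fun q : R * R => (0 < q.2 < b - q.1)%R%:R *
      (P q - \int[mu]_y ((0 < y <= q.2)%R%:R * N (q.1, y))))).
    apply: measurable_funM; last exact: measurable_funB.
    apply: measurable_fun_natr_bool; apply: measurable_and.
      by apply: measurable_fun_ltr.
    by apply: measurable_fun_ltr => //; apply: measurable_funB.
  apply: (@measurableT_comp _ _ _ _ _ _ (fun x : R => x `^ (-1))); first exact: measurable_powR.
  exact: measurable_funB.
have sec : {ae mu, forall s, 0 < s < b -> c s = g s 0 /\
      forall x, 0 <= x <= b - s -> g s x = g s 0 + \int[mu]_(y in `]0, x]) N (s, y)}.
  apply: (ae_imp gP) => s /[swap] sb /(_ sb) gPs; have /andP[s0 s1] := sb.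
  have sb' : 0 <= s <= b by rewrite !ltW.
  have bs : 0 <= b - s by rewrite subr_ge0 ltW.
  have [phi [phii phiE dphi]] := absolutely_continuous_FTC bs (gAC s sb').
  have Nphi : {ae mu, forall x, 0 < x < b - s -> phi x = N (s, x)}.
    (* [P] agrees with [g s] only almost everywhere, so all the shifted points x + 1/(n+1) must be
       good at once; there are countably many. *)
    have gPn : {ae mu, forall x, forall n, 0 < x + n.+1%:R^-1 < b - s ->
        g s (x + n.+1%:R^-1) = P (s, x + n.+1%:R^-1)}.
      apply: ae_foralln => n; apply: (ae_imp (ae_shift (- n.+1%:R^-1) gPs)) => x.
      by rewrite opprK.
    apply: (ae_imp2 (ae_imp2 dphi gPn (fun x => @conj _ _))
      (ae_imp2 gPs (gb s sb') (fun x => @conj _ _))) => x [H1 H2] [H3 H4] xb; have [dx dE] := H1 xb; have {}H3 := H3 xb.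
    have {}H4 := H4 xb; have /andP[x0 x1] := xb.
    have N0E : N0 (s, x) = derive1 (g s) x.
      have cvD : (D n (s, x))%:E @[n --> \oo] --> (derive1 (g s) x)%:E.
        apply: cvg_EFin; first exact: nearW.
        have bsx : 0 < b - s - x by rewrite subr_gt0.
        apply: cvg_trans (cvg_diff_quotient dx); apply: near_eq_cvg; near=> n.
        rewrite /D /= H3 H2//; apply/andP; split; first by rewrite ltr_wpDr// invr_ge0.
        rewrite addrC -ltrBrDr; near: n; exact: (near_infty_natSinv_lt (PosNum bsx)).
      by rewrite /N0 is_cvg_limn_esupE; [rewrite (cvg_lim _ cvD)|apply/cvg_ex; eexists; exact: cvD].
    rewrite -dE /N /= N0E; have gbx : `|gbar x| = gbar x.
      by rewrite ger0_norm// (le_trans _ H4).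
    move: H4; rewrite ler_norml gbx => /andP[h1 h2].
    by rewrite (min_idPr h2) (max_idPr h1).
  have gE x : 0 <= x <= b - s -> g s x = g s 0 + \int[mu]_(y in `]0, x]) N (s, y).
    move=> /andP[x0 xb]; rewrite -(subrK (g s 0) (g s x)) phiE ?x0// addrC; congr (_ + _).
    apply: ae_eq_Rintegral; apply: (ae_imp2 Nphi (ae_neq (b - s))) => y H1 H2 /=.
    rewrite in_itv/= => /andP[y0 yx]; apply: H1; rewrite y0 lt_neqAle H2 /=.
    exact: le_trans yx xb.
  split=> //; rewrite /c powR_inv1 ?subr_ge0 ?ltW//.
  have -> : \int[mu]_x ((0 < x < b - s)%R%:R *
      (P (s, x) - \int[mu]_y ((0 < y <= x)%R%:R * N (s, y)))) =
      \int[mu]_(x in `]0, b - s[) (cst (g s 0)) x.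
    rewrite [RHS]Rintegral_mkcond; apply: ae_eq_Rintegral; apply: (ae_imp gPs) => x Hx _.
    rewrite patchE; case: ifPn => [/set_mem|/negP]; last first.
      move=> nx; rewrite (_ : (_ < x < _) = false) ?mul0r//.
      by apply/negP => xb; apply: nx; rewrite inE /= in_itv.
    rewrite /= in_itv/= => xb; rewrite xb mul1r -Hx//; have /andP[x0 x1] := xb.
    rewrite (gE x) ?ltW//; apply/eqP; rewrite subr_eq; apply/eqP; congr (_ + _).
    rewrite Rintegral_mkcond; apply: eq_Rintegral => y _; rewrite patchE.
    case: ifPn => [/set_mem|/negP]; first by rewrite /= in_itv/= => ->; rewrite mul1r.
    move=> ny; rewrite (_ : (_ < y <= _) = false) ?mul0r//.
    by apply/negP => yx; apply: ny; rewrite inE /= in_itv.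
  rewrite Rintegral_cst; last exact: measurable_itv.
  rewrite (_ : fine _ = b - s); last first.
    transitivity (fine (lebesgue_measure (`]0, b - s[%classic : set R))) => //.
    by rewrite lebesgue_measure_itv/= lte_fin subr_gt0 s1 /= subr0.
  by rewrite mulrC mulfK// gt_eqF// subr_gt0.
exists N, c; split => //.
(* Lebesgue points are abundant for each [s], while the claim is about almost every [s] for almost
   every [t]. The pairs (s, t) such that t - s is a Lebesgue point of the section at [s] form a
   Borel set, so the quantifiers can be exchanged. *)
have mLS : measurable ([set p | lebesgue_sections N (p.1, p.2 - p.1)] :
    set (measurableTypeR R * measurableTypeR R)).
  rewrite -[X in measurable X]setTI.
  have mm : measurable_fun setT (fun p : R * R => (p.1, p.2 - p.1)).
    by apply: measurable_fun_pair => //=; exact: measurable_funB.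
  exact: (mm measurableT _ (measurable_lebesgue_sections mN)).
have LS : {ae mu, forall s, {ae mu, forall t, lebesgue_sections N (s, t - s)}}.
  apply: aeW => s; apply: (@ae_shift R s (fun x => lebesgue_sections N (s, x))).
  apply: (ae_imp (lebesgue_differentiation (open_integrable_locally openT (Ni s)))) => x.
  by move=> lp; apply/lebesgue_sectionsP.
apply: (ae_imp (@ae_swap _ _ _ _ _ mu mu _ mLS LS)) => t Ht /andP[t0 tb].
apply: (ae_imp2 Ht sec) => s /= Hs1 Hs2 /andP[s0 st].
have [|_ gE] := Hs2; first by rewrite s0 (lt_trans st).
have xs0 : 0 < t - s by rewrite subr_gt0.
have xsb : t - s < b - s by rewrite ltrD2r.
have lp : lebesgue_pt (fun y => N (s, y)) (t - s) by apply/lebesgue_sectionsP.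
have [||dF0 <-] := @FTC1_lebesgue_pt R (fun y => N (s, y)) (BRight 0) (t - s) (b - s) xsb _ _ lp.
- by have := Ni s; apply: integrableS.
- by [].
set F0 := (fun y => _) in dF0 *.
pose F1 : R -> R := F0 + cst (g s 0).
have dF1 : derivable F1 (t - s) 1 := derivableD dF0 (derivable_cst (g s 0) (t - s) 1).
have [|dF ->] := @near_eq_derive1 R F1 (g s) (t - s) _ dF1.
  near=> y; change (F0 y + g s 0 = g s y); rewrite [RHS](gE y); first by rewrite addrC.
  by apply/andP; split; apply: ltW; near: y; [exact: (lt_nbhsr xs0)|exact: (lt_nbhsl xsb)].
by rewrite !derive1E (deriveD dF0 (derivable_cst (g s 0) (t - s) 1)) derive_cst addr0.
Unshelve. all: by end_near. Qed.

End section_derivative.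

(** * Volterra equations *)

Section volterra.
Context (R : realType).
Notation mu := (@lebesgue_measure R).
Notation L1R f := (mu.-integrable [set: R] (EFin \o f)).

Lemma ae_exists (P : R -> Prop) (x y : R) : x < y -> {ae mu, forall z, P z} ->
  exists2 z, x < z < y & P z.
Proof.
move=> xy [A [mA A0 PA]]; apply: contrapT => nP.
have mxy : measurable (`]x, y[%classic : set (measurableTypeR R)) by exact: measurable_itv.
have : (mu (`]x, y[%classic : set R) <= mu A)%E.
  apply: le_measure; rewrite ?inE//.
  move=> z /=; rewrite in_itv/= => zxy; apply: PA => /= Pz; apply: nP.
  by exists z.
rewrite A0 lebesgue_measure_itv/= lte_fin xy -EFinB lee_fin.
by rewrite leNgt subr_gt0 xy.
Qed.

(** At a Lebesgue point [t] the primitive has derivative [q t]. For almost every such [t] it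
    vanishes at [t] and at points arbitrarily close on the right, so the derivative can only be
    0. *)
Lemma primitive_eq0 (b : R) (q : R -> R) : L1R q ->
  {ae mu, forall t, 0 < t < b -> \int[mu]_(s in `]0, t]) q s = 0} ->
  {ae mu, forall t, 0 < t < b -> q t = 0}.
Proof.
move=> qi q0.
have lq : {ae mu, forall x, lebesgue_pt q x}.
  exact: (lebesgue_differentiation (open_integrable_locally openT qi)).
apply: (ae_imp2 lq q0).
move=> t lp Ft0 tb; have {}Ft0 := Ft0 tb; have /andP[t0 t1] := tb.
have [||] := @FTC1_lebesgue_pt R q (BRight 0) t b t1 _ _ lp.
- by apply: integrableS qi.
- by [].
set F := (fun y => _) => dF dFE; apply/eqP; rewrite -normr_le0; apply/ler_addgt0Pl => e e0.
rewrite addr0; move: dF; rewrite /derivable => cF.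
have : (fun h : R => h^-1 *: (F (h *: 1 + t) - F t)) @ 0^' --> q t.
  by move: cF; rewrite -dFE derive1E; exact.
move=> /cvgrPdist_lt/(_ _ e0)[d /= d0 Hd].
pose d1 := Num.min d (b - t); have d10 : 0 < d1 by rewrite lt_min d0 subr_gt0.
have td1 : t < t + d1 by rewrite ltrDl.
have [z /andP[tz zd] Fz0] := ae_exists td1 q0.
have /andP[zd2 zb] : (z < t + d) && (z < b).
  by move: zd; rewrite -ltrBDl /d1 lt_min ltrD2r ltrBDl.
have {}Fz0 : F z = 0 by apply: Fz0; rewrite zb (lt_trans t0 tz).
have := Hd (z - t); rewrite /ball_ /= sub0r normrN gtr0_norm ?subr_gt0// ltrBDl => /(_ zd2).
rewrite subr_eq0 gt_eqF// => /(_ isT).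
rewrite [_ *: 1]mulr1 subrK Fz0 [F t]Ft0 subrr scaler0 subr0.
exact: ltW.
Qed.

(* For n large, the weight exp (- n x) makes convolution with A a strict contraction
   of L1. *)
Lemma gronwall_L1 (A r : R -> R) : L1R A -> L1R r ->
  (forall x, 0 <= A x) -> (forall x, 0 <= r x) ->
  (forall x, x <= 0 -> A x = 0) -> (forall x, x <= 0 -> r x = 0) ->
  {ae mu, forall t, r t <= \int[mu]_s (A (t - s) * r s)} ->
  {ae mu, forall t, r t = 0}.
Proof.
move=> Ai ri A0 r0 An rn rle.
have mA := measurable_L1R Ai; have mr := measurable_L1R ri.
pose e n (x : R) := expR (- (n.+1%:R * x)).
have me n : measurable_fun setT (e n).
  apply: (measurableT_comp (@measurable_expR R)).
  apply: (@measurable_funN _ _ _ _ (fun x : R => n.+1%:R * x)).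
  exact: mulrl_measurable.
have e1 n x : 0 <= x -> e n x <= 1.
  by move=> x0; rewrite /e -[leRHS]expR0 ler_expR oppr_le0 mulr_ge0.
(* The exponential is multiplicative, so the weight distributes over the two factors of the
   convolution. *)
have eB n t s : e n t = e n (t - s) * e n s.
  by rewrite /e -expRD; congr expR; ring.
have damp n (f : R -> R) : (forall x, 0 <= f x) -> (forall x, x <= 0 -> f x = 0) ->
    L1R f -> L1R (fun x => e n x * f x).
  move=> f0 fn fi; have := fi; apply: le_integrable => //.
    by apply/measurable_EFinP; apply: (measurable_funM (me n) (measurable_L1R fi)).
  move=> x _; rewrite /= lee_fin; have [x0|x0] := ltP x 0.
    by rewrite (fn _ (ltW x0)) mulr0.
  by rewrite normrM ler_piMl// ger0_norm ?expR_ge0// e1.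
have lim : (\int[mu]_x (e n x * A x))%R @[n --> \oo] --> (0 : R).
  have -> : (0 : R) = \int[mu]_x (0 : R) by rewrite Rintegral_cst// mul0r.
  apply: (@Rintegral_dominated _ _ _ mu _ _ _ A) => //.
  - by move=> n; exact: (measurable_funM (me n) mA).
  - move=> x _; have [x0|x0] := leP x 0.
      by under eq_fun do rewrite An// mulr0; exact: cvg_cst.
    rewrite -[X in _ --> X](mul0r (A x)); apply: cvgMl => //.
    have -> : (fun n => e n x) = (fun n : nat => expR (- x) ^+ n.+1).
      by apply/funext => m; rewrite /e -expRM_natl mulrN.
    rewrite (cvg_shiftS (fun n => expR (- x) ^+ n)); apply: (@cvg_expr R (expR (- x))).
    by rewrite ger0_norm ?expR_ge0// expR_lt1 oppr_lt0.
  - move=> n x _; have [x0|/ltW x0] := leP x 0; first by rewrite An ?mulr0 ?normr0.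
    by rewrite normrM (ger0_norm (A0 x)) ler_piMl// ger0_norm ?expR_ge0// e1.
have [n nlt] : exists n, \int[mu]_x (e n x * A x) < 1.
  have [N _ HN] := (cvgr_lt _ lim _ ltr01); exists N; exact: (HN N (leqnn N)).
have eAi := damp n A A0 An Ai; have eri := damp n r r0 rn ri.
pose I := \int[mu]_t (e n t * r t).
have ki : (mu \x mu)%E.-integrable setT (EFin \o (fun p : R * R =>
    (e n (p.2 - p.1) * A (p.2 - p.1)) * (e n p.1 * r p.1))).
  apply: (@integrable_kernel R (fun x => `|e n x * A x|) (fun x => e n x * r x)
    (fun p : R * R => (e n (p.2 - p.1) * A (p.2 - p.1)))) => //.
  - exact: integrable_abse eAi.
  - exact: (measurable_conv_kernel (measurable_L1R eAi)).
have Ile : I <= \int[mu]_x (e n x * A x) * I.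
  have -> : \int[mu]_x (e n x * A x) * I =
     \int[mu]_t \int[mu]_s ((e n (t - s) * A (t - s)) * (e n s * r s)).
    rewrite -(fubini_Rintegral ki) /= /I -Rintegral_mull//; last exact: (measurable_L1R eri).
    apply: eq_Rintegral => s _.
    rewrite -(@Rintegral_shift _ s (fun x => e n x * A x)); last exact: (measurable_L1R eAi).
    rewrite mulrC -Rintegral_mull; [|by []|].
      by apply: eq_Rintegral => t _; rewrite mulrC.
    apply: (measurableT_comp (measurable_L1R eAi)).
    exact: measurable_funB.
  have Ki := integrable_Rintegral2 ki.
  (* The hypothesis holds only almost everywhere, whereas [le_Rintegral] compares pointwise: the
     left integrand is replaced by its minimum with the right one, to which it is almost everywhere
     equal. *)
  rewrite /I (@ae_eq_Rintegral _ _ _ mu _ (fun t => e n t * r t) (fun t => Num.min (e n t * r t)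
    (\int[mu]_s ((e n (t - s) * A (t - s)) * (e n s * r s))))).
  - apply: le_Rintegral => //.
    - have := Ki; apply: le_integrable => //.
        apply/measurable_EFinP; apply: measurable_minr; first exact: (measurable_L1R eri).
        exact: measurable_L1R Ki.
      move=> t _; rewrite /= lee_fin ger0_norm; last first.
        rewrite le_min mulr_ge0 ?expR_ge0//=; apply: Rintegral_ge0 => s _.
        by rewrite !mulr_ge0 ?expR_ge0.
      by rewrite (le_trans _ (ler_norm _))// ge_min lexx orbT.
    - by move=> t _; rewrite ge_min lexx orbT.
  - apply: (ae_imp rle) => t rt _; apply/esym/min_idPl.
    apply: (le_trans (ler_wpM2l (expR_ge0 _) rt)).
    rewrite -Rintegral_mull//; last first.
      apply: measurable_funM => //; apply: (measurableT_comp mA); exact: measurable_funB.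
    rewrite le_eqVlt; apply/orP; left; apply/eqP; apply: eq_Rintegral => s _.
    by rewrite -/(e n t) (eB n t s); ring.
have I0 : I = 0.
  apply: le_anti; rewrite Rintegral_ge0 ?andbT => [|x _]; last by rewrite mulr_ge0// expR_ge0.
  have : (1 - \int[mu]_x (e n x * A x)) * I <= 0 by rewrite mulrBl mul1r subr_le0.
  by rewrite pmulr_rle0// subr_gt0.
have : ae_eq mu setT (fun t => (e n t * r t)%:E) (cst 0%E).
  apply/ae_eq_integral_abs => //; first exact: (measurable_int _ eri).
  rewrite -[RHS]/(0%:E) -I0 /I /Rintegral fineK; last exact: (integrable_fin_num measurableT eri).
  by apply: eq_integral => t _; rewrite gee0_abs// lee_fin mulr_ge0// expR_ge0.
move=> H; apply: (ae_imp H) => t /= /(_ Logic.I) [] /eqP; rewrite mulf_eq0 gt_eqF ?expR_gt0//=.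
by move/eqP.
Qed.

End volterra.

(** * Primitives of Volterra operators and uniqueness *)

Section volterra_kernels.
Context (R : realType).
Notation mu := (@lebesgue_measure R).
Notation L1R f := (mu.-integrable [set: R] (EFin \o f)).

Lemma integrable_itv_bool (b : R) : L1R (fun x => (0 < x < b)%R%:R : R).
Proof.
have := integrable_indic_itv 0 b false true; apply: eq_integrable => // x _ /=.
by rewrite indicE mem_setE in_itv.
Qed.

Lemma Rintegral_itv_bool (x : R) (f : R -> R) :
  \int[mu]_(y in `]0, x]) f y = \int[mu]_y ((0 < y <= x)%R%:R * f y).
Proof.
rewrite Rintegral_mkcond; apply: eq_Rintegral => y _; rewrite patchE mem_setE in_itv/=.
by case: ifP => _; rewrite ?mul1r ?mul0r.
Qed.

(** Exchanging the integrals in the primitive of [G] turns an integral over r in ]s,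
    t[ into one over y = r - s in ]0, t - s[. It serves both for the kernel of the second-kind
    equation and, with constant [c] and [N] independent of [s], for the uniqueness of solutions. *)
Lemma primitive_kernel (b C : R) (d c gbar : R -> R) (N : R * R -> R)
    (G := fun r => \int[mu]_s ((s < r)%R%:R * N (s, r - s) * d s)) :
  L1R d -> (forall s, s <= 0 -> d s = 0) ->
  measurable_fun setT c -> (forall s, `|c s| <= C) ->
  L1R gbar -> measurable_fun setT N -> (forall s y, `|N (s, y)| <= `|gbar y|) ->
  L1R G /\
  {ae mu, forall t, 0 < t < b ->
    \int[mu]_s (d s * ((s < t)%R%:R * (c s + \int[mu]_(y in `]0, t - s]) N (s, y)))) =
    \int[mu]_(r in `]0, t]) (d r * c r + G r)}.
Proof.
move=> di dn mc cC gi mN Ng; have md := measurable_L1R di.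
pose M (p : R * R) := (p.1 < p.2)%R%:R * N (p.1, p.2 - p.1).
have mM : measurable_fun setT M.
  apply: measurable_funM; first by apply: measurable_fun_natr_bool; exact: measurable_fun_ltr.
  by apply: (measurableT_comp mN); apply: measurable_fun_pair => //=; exact: measurable_funB.
have Mg s r : `|M (s, r)| <= `|gbar (r - s)|.
  rewrite normrM /=; apply: (le_trans _ (Ng s (r - s))).
  by case: (s < r); rewrite ?normr1 ?normr0 ?mul1r ?mul0r.
have agi : L1R (fun x => `|gbar x|) := integrable_abse gi.
have Gi : L1R G := integrable_Rintegral2 (integrable_kernel agi di mM Mg).
split=> //; have ii := integrable_itv_bool b.
(* Convolution with the indicator of ]0, b[ is integration up to [t]: for r > 0 and t < b the
   condition t - r < b is automatic. *)
apply: (ae_imp (kernel_fubini ii agi di mM Mg)) => t KF tb; have /andP[t0 t1] := tb.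
pose X s := \int[mu]_r ((0 < t - r < b)%R%:R * M (s, r)).
have mH : measurable_fun setT (fun q : R * R => (0 < t - q.2 < b)%R%:R * M q).
  apply: measurable_funM => //; apply: (measurable_fun_natr_bool (c := fun q : R * R => 0 < t - q.2 < b)).
  by apply: measurable_and; apply: measurable_fun_ltr => //; apply: measurable_funB.
have mX : measurable_fun setT X by exact: (@measurable_Rintegral1 _ _ _ _ _ mu _ mH).
have XC s : `|X s| <= \int[mu]_x `|gbar x|.
  have HM r : `|(0 < t - r < b)%R%:R * M (s, r)| <= `|gbar (r - s)|.
    rewrite normrM; apply: (le_trans _ (Mg s r)).
    by case: (_ < _ < _); rewrite ?normr1 ?normr0 ?mul1r ?mul0r.
  have mHs : measurable_fun setT (fun r : R => (0 < t - r < b)%R%:R * M (s, r)).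
    exact: measurableT_comp mH (pair1_measurable s).
  have gsi : L1R (fun r => gbar (r - s)).
    exact: (integrable_comp_preserving (measurable_shift s) (@lebesgue_measure_shift R s) gi).
  have Hi : L1R (fun r : R => (0 < t - r < b)%R%:R * M (s, r)).
    exact: (L1R_dominated mHs gsi HM).
  rewrite -(@Rintegral_shift R s (fun x => `|gbar x|)); last exact: measurable_L1R agi.
  apply: (le_trans (le_normr_Rintegral _ Hi)) => //; apply: le_Rintegral => //.
  - exact: integrable_abse Hi.
  - exact: integrable_abse gsi.
have dXi : L1R (fun s => d s * X s) by exact: (integrableM_bounded measurableT di _ (fun s _ => XC s)).
have dci : L1R (fun s => d s * c s) by exact: (integrableM_bounded measurableT di _ (fun s _ => cC s)).
have XE s : 0 < s -> X s = (s < t)%R%:R * \int[mu]_(y in `]0, t - s]) N (s, y).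
  move=> s0; have [st|ts] := ltP s t; last first.
    rewrite mul0r /X -[RHS](mul0r (fine (mu setT))) -Rintegral_cst//; apply: eq_Rintegral => r _.
    rewrite /M /=; have [sr|] := ltP s r; rewrite ?mul0r ?mulr0//.
    by rewrite subr_gt0 ltNge (le_trans ts (ltW sr)) /= mul0r.
  rewrite mul1r Rintegral_itv_bool -(@Rintegral_shift R s); last first.
    apply: measurable_funM; last exact: measurableT_comp mN (pair1_measurable s).
    apply: measurable_fun_natr_bool; apply: measurable_and; [exact: measurable_fun_ltr|exact: measurable_fun_ler].
  apply: ae_eq_Rintegral; apply: (ae_imp (ae_neq t)) => r rt _.
  rewrite /M /= mulrA; congr (_ * _); rewrite !subr_gt0 lerD2r le_eqVlt (negbTE rt) /=.
  have [sr|] := ltP s r; rewrite ?mulr0 ?mulr1//=.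
  rewrite (_ : (t - r < b) = true) ?andbT//; rewrite ltrBlDr; apply: (lt_trans t1).
  by rewrite ltrDl (lt_trans s0).
have split1 : \int[mu]_(r in `]0, t]) (d r * c r + G r) =
    \int[mu]_(r in `]0, t]) (d r * c r) + \int[mu]_(r in `]0, t]) G r.
  rewrite RintegralD//; [by apply: integrableS dci|by apply: integrableS Gi].
rewrite split1.
have E1 : \int[mu]_(r in `]0, t]) G r = \int[mu]_s (d s * X s).
  rewrite -KF Rintegral_itv_bool; apply: ae_eq_Rintegral; apply: (ae_imp (ae_neq t)) => r rt _.
  have [r0|r0] := leP r 0.
    rewrite [G r](_ : _ = 0) ?mulr0; last first.
      rewrite /G -[RHS](mul0r (fine (mu setT))) -Rintegral_cst//; apply: eq_Rintegral => s _.
      have [sr|] := ltP s r; rewrite ?mul0r//.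
      by rewrite dn ?mulr0//; exact: le_trans (ltW sr) r0.
    rewrite [X in _ * X](_ : _ = 0) ?mulr0//.
    rewrite -[RHS](mul0r (fine (mu setT))) -Rintegral_cst//; apply: eq_Rintegral => s _.
    rewrite /M /=; have [sr|] := ltP s r; rewrite ?mul0r//.
    by rewrite dn ?mulr0//; exact: le_trans (ltW sr) r0.
  rewrite /G /M /= le_eqVlt (negbTE rt) /= subr_gt0.
  by rewrite (_ : (t - r < b) = true) ?andbT// ltrBlDr (lt_trans t1)// ltrDl.
have E2 : \int[mu]_(r in `]0, t]) (d r * c r) = \int[mu]_s ((s < t)%R%:R * (d s * c s)).
  rewrite Rintegral_itv_bool; apply: ae_eq_Rintegral; apply: (ae_imp (ae_neq t)) => r rt _.
  have [r0|r0] := leP r 0; first by rewrite dn// !(mul0r, mulr0).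
  by rewrite le_eqVlt (negbTE rt).
rewrite E1 E2 -RintegralD//; last first.
  have := dci; apply: le_integrable => //.
    apply/measurable_EFinP/measurable_funM; last exact: measurable_funM.
    by apply: measurable_fun_natr_bool; exact: measurable_fun_ltr.
  move=> s _; rewrite /= lee_fin normrM.
  by case: (s < t); rewrite ?normr1 ?normr0 ?mul1r ?mul0r.
apply: eq_Rintegral => s _; have [s0|s0] := leP s 0; first by rewrite dn// !mul0r mulr0 addr0.
by rewrite XE//; ring.
Qed.

(* Convolving K * r = 0 with k gives c0 r + phi * r = 0, a Volterra equation of the
   second kind. *)
Lemma volterra_unique (b c0 : R) (K k phi r : R -> R) :
  L1R K -> L1R k -> L1R phi -> L1R r -> c0 != 0 ->
  (forall x, x <= 0 -> K x = 0) -> (forall x, x <= 0 -> k x = 0) ->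
  (forall x, ~~ (0 < x < b) -> r x = 0) ->
  {ae mu, forall x, 0 < x < b ->
    \int[mu]_z (K (x - z) * k z) = c0 + \int[mu]_(y in `]0, x]) phi y} ->
  {ae mu, forall t, 0 < t < b -> \int[mu]_s (K (t - s) * r s) = 0} ->
  {ae mu, forall t, r t = 0}.
Proof.
move=> Ki ki phii ri c00 Kn kn rn Kk Kr.
have mK := measurable_L1R Ki; have mk := measurable_L1R ki.
have mr := measurable_L1R ri; have mphi := measurable_L1R phii.
have rn0 x : x <= 0 -> r x = 0 by move=> x0; rewrite rn// negb_and -leNgt x0.
have aKi : L1R (fun x => `|K x|) := integrable_abse Ki.
have mN : measurable_fun setT (fun p : R * R => phi p.2).
  by apply: (measurableT_comp mphi); exact: measurable_snd.
have [Gi PK] := @primitive_kernel b `|c0| r (fun=> c0) phi (fun p => phi p.2)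
  ri rn0 (measurable_cst c0) (fun=> lexx _) phii mN (fun _ _ => lexx _).
set G := (fun r0 => _) in Gi PK.
pose q t := r t * c0 + G t.
have qi : L1R q.
  have := integrableD measurableT (integrableZl measurableT c0 ri) Gi.
  by apply: eq_integrable => // x _; rewrite /q /= EFinD EFinM muleC.
have q0 : {ae mu, forall t, 0 < t < b -> q t = 0}.
  apply: primitive_eq0 => //.
  (* Associativity: by [Kk] the primitive of [q] is (k * K) * r, hence k * (K * r), which
     vanishes. *)
  have KF := kernel_fubini ki aKi ri (measurable_conv_kernel mK) (fun s t => lexx _).
  apply: (ae_imp2 KF PK) => t KFt PKt tb; rewrite -PKt//; have /andP[t0 t1] := tb.
  transitivity (\int[mu]_s (r s * \int[mu]_z (k (t - z) * K (z - s)))).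
    apply: ae_eq_Rintegral; apply: (ae_imp (ae_reflect t Kk)) => s Ks _.
    have [s0|s0] := leP s 0; first by rewrite rn0// !mul0r.
    congr (_ * _); have [st|ts] := ltP s t; last first.
      rewrite mul0r -[LHS](mul0r (fine (mu setT))) -Rintegral_cst//; apply: eq_Rintegral => z _.
      have [tz|zt] := leP t z; first by rewrite kn ?mul0r// subr_le0.
      by rewrite Kn ?mulr0// subr_le0 ltW// (lt_le_trans zt).
    rewrite mul1r -Ks; last by rewrite subr_gt0 st /= ltrBlDr (lt_trans t1)// ltrDl.
    rewrite -(@Rintegral_reflect R t (fun z => K (t - s - z) * k z)); last first.
      apply: measurable_funM => //; apply: (measurableT_comp mK); exact: measurable_funB.
    apply: eq_Rintegral => z _; rewrite [LHS]mulrC (_ : t - s - (t - z) = z - s)//.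
    by ring.
  rewrite -KFt -[RHS](mul0r (fine (mu setT))) -Rintegral_cst//; apply: ae_eq_Rintegral.
  apply: (ae_imp Kr) => z Krz _; have [tz|zt] := leP t z.
    by rewrite kn ?mul0r// subr_le0.
  have [z0|z0] := leP z 0; last by rewrite Krz ?mulr0// z0 (lt_trans zt).
  rewrite [X in _ * X](_ : _ = 0) ?mulr0//.
  rewrite -[RHS](mul0r (fine (mu setT))) -Rintegral_cst//; apply: eq_Rintegral => s _.
  have [s0|s0] := leP s 0; first by rewrite rn0// mulr0.
  by rewrite Kn ?mul0r// subr_le0 (le_trans z0)// ltW.
pose A (x : R) := `|(0 < x)%R%:R * phi x / c0|.
have mA : measurable_fun setT (fun x : R => (0 < x)%R%:R * phi x / c0).
  apply: measurable_funM => //; apply: measurable_funM => //.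
  by apply: measurable_fun_natr_bool; exact: measurable_fun_ltr.
have Ai : L1R A.
  have := integrable_abse (integrableZl measurableT c0^-1 phii).
  apply: le_integrable => //; first by apply/measurable_EFinP; exact: measurableT_comp.
  move=> x _; rewrite /= lee_fin /A normr_id normr_id mulrC normrM [leRHS]normrM ler_wpM2l//.
  by case: (0 < x); rewrite ?mul1r// mul0r normr0.
have ari : L1R (fun x => `|r x|) := integrable_abse ri.
suff : {ae mu, forall t, `|r t| = 0} by move=> H; apply: (ae_imp H) => t /normr0_eq0.
apply: (gronwall_L1 Ai ari) => //.
- by move=> x; rewrite /A.
- by move=> x x0; rewrite /A ltNge x0 !mul0r normr0.
- by move=> x x0; rewrite rn0// normr0.
have kiA : (mu \x mu)%E.-integrable setT (EFin \o (fun p : R * R =>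
    ((0 < p.2 - p.1)%R%:R * phi (p.2 - p.1) / c0) * r p.1)).
  exact: (integrable_kernel Ai ri (measurable_conv_kernel mA) (fun s t => lexx _)).
have kA := ae_integrable2 kiA.
apply: (ae_imp2 q0 kA) => t qt kt; have [tb|tb] := boolP (0 < t < b); last first.
  by rewrite rn// normr0; apply: Rintegral_ge0 => s _; rewrite mulr_ge0 // /A.
have kt' : L1R (fun s : R => (0 < t - s)%R%:R * phi (t - s) / c0 * r s) := kt.
have rE : r t = - \int[mu]_s ((0 < t - s)%R%:R * phi (t - s) / c0 * r s).
  apply: (mulIf c00); rewrite mulNr; apply/eqP; rewrite -addr_eq0; apply/eqP.
  rewrite -[RHS](qt tb) /q; congr (_ + _); rewrite [LHS]mulrC.
  apply: (eq_trans (esym (@Rintegral_mull _ _ _ mu setT _ c0 measurableT (measurable_L1R kt')))).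
  by apply: eq_Rintegral => s _; rewrite subr_gt0 /=; field.
rewrite rE normrN; apply: (le_trans (le_normr_Rintegral _ kt)) => //.
by rewrite le_eqVlt; apply/orP; left; apply/eqP; apply: eq_Rintegral => s _; rewrite normrM.
Qed.

End volterra_kernels.

(** * The weighted Sonine condition *)

Section extension_and_truncation.
Context (R : realType).
Notation mu := (@lebesgue_measure R).
Notation L1R f := (mu.-integrable [set: R] (EFin \o f)).

(** Cutting off both factors makes an integral over ]0, t[ with t < b a convolution over the line:
    the integrand vanishes by itself for s <= 0 and for s >= t. *)
Definition zext (b : R) (f : R -> R) (x : R) : R := if 0 < x < b then f x else 0.

Lemma zext_in b f x : 0 < x < b -> zext b f x = f x.
Proof. by rewrite /zext => ->. Qed.

Lemma zext_out b f x : ~~ (0 < x < b) -> zext b f x = 0.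
Proof. by rewrite /zext => /negbTE ->. Qed.

Lemma zext_le0 b f x : x <= 0 -> zext b f x = 0.
Proof. by move=> x0; rewrite zext_out// negb_and -leNgt x0. Qed.

Lemma zext_integrable b f : L1 b f -> L1R (zext b f).
Proof.
move=> fi; have mD : measurable (`]0, b[%classic : set (measurableTypeR R)) by exact: measurable_itv.
have := (integrable_mkcond _ mD).1 fi; apply: eq_integrable => // x _.
by rewrite patchE mem_setE in_itv /= /zext; case: ifP.
Qed.

Lemma completed_restrict d (T : measurableType d) (nu : {measure set T -> \bar R})
    (D : set T) (f : T -> R) : measurable D -> completed_measurable_fun nu D f ->
  exists2 f', measurable_fun setT f' & {ae nu, forall x, D x -> f x = f' x}.
Proof.
move=> mD [f' mf' ff']; exists (f' \_ D); first exact/(measurable_restrictT _ mD).1.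
by apply: (ae_imp ff') => x fx Dx; rewrite patchE mem_set// fx.
Qed.

Lemma clampK (M x : R) : `|x| <= M -> Num.max (- M) (Num.min M x) = x.
Proof. by rewrite ler_norml => /andP[h1 h2]; rewrite (min_idPr h2) (max_idPr h1). Qed.

Lemma clamp_norm (M x : R) : 0 <= M -> `|Num.max (- M) (Num.min M x)| <= M.
Proof.
move=> M0; rewrite ler_norml le_max lexx /= ge_max; apply/andP; split.
  by rewrite (le_trans _ M0)// oppr_le0.
by rewrite ge_min lexx.
Qed.

Lemma measurable_clamp d (T : measurableType d) (M : R) (f : T -> R) :
  measurable_fun setT f -> measurable_fun setT (fun x => Num.max (- M) (Num.min M (f x))).
Proof. by move=> mf; apply: measurable_maxr => //; exact: measurable_minr. Qed.

Lemma measurable_set_bool d (T : measurableType d) (c : T -> bool) :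
  measurable_fun setT c -> measurable [set x | c x].
Proof.
move=> mc; rewrite -[X in measurable X]setTI (_ : [set x | c x] = c @^-1` [set true]).
  exact: mc.
by apply/seteqP; split.
Qed.

(** The diagonal is bounded by hypothesis, and the increment from it is at most the L1 norm of
    [wbar], by translation. *)
Lemma admissible_weight_bounded b w : admissible_weight b w ->
  exists2 B : R, 0 <= B & forall s t, 0 <= s -> s <= t -> t <= b -> `|w s t| <= B.
Proof.
move=> [_ wAC [m [M [mM Mw]]] [wbar wbi wb]].
have wEi := zext_integrable wbi; have awEi : L1R (fun x => `|zext b wbar x|) := integrable_abse wEi.
have M0 : 0 <= M by case/andP: mM => m0 mM; rewrite (le_trans (ltW m0)).
exists (M + \int[mu]_x `|zext b wbar x|) => [|s t s0 st tb].
  by rewrite addr_ge0//; exact: Rintegral_ge0.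
have sb : s <= b := le_trans st tb; have s0b : 0 <= s <= b by rewrite s0.
have [phi [phii phiE dphi]] := absolutely_continuous_FTC sb (wAC s s0b).
rewrite -(subrK (w s s) (w s t)) phiE ?st// addrC; apply: (le_trans (ler_normD _ _)).
apply: lerD; first by have /andP[] := Mw s s0b.
have mst : measurable (`]s, t]%classic : set (measurableTypeR R)) by exact: measurable_itv.
have phist : mu.-integrable `]s, t] (EFin \o phi) by apply: integrableS phii.
apply: (le_trans (le_normr_Rintegral mst phist)).
rewrite -(@Rintegral_shift R s); last exact: measurable_L1R awEi.
have wsi : L1R (fun y => `|zext b wbar (y - s)|).
  exact: (integrable_comp_preserving (measurable_shift s) (@lebesgue_measure_shift R s) awEi).
apply: (@le_trans _ _ (\int[mu]_(y in `]s, t]) `|zext b wbar (y - s)|)); last first.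
  rewrite Rintegral_mkcond; apply: le_Rintegral => //.
    have wst : mu.-integrable `]s, t] (EFin \o (fun y => `|zext b wbar (y - s)|)).
      by have wsi' := wsi; apply: integrableS wsi'.
    have := (integrable_mkcond _ mst).1 wst; apply: eq_integrable => // x _.
    by rewrite /= !patchE; case: ifP.
  by move=> x _; rewrite patchE; case: ifP; rewrite ?lexx ?normr_ge0.
rewrite (@ae_eq_Rintegral _ _ _ mu _ (fun y => `|phi y|) (fun y => Num.min `|phi y| `|zext b wbar (y - s)|)).
  apply: le_Rintegral => //.
  - have := integrable_abse phist; apply: le_integrable => //.
      apply/measurable_EFinP/measurable_funTS; apply: measurable_minr; last exact: measurable_L1R.
      by apply: measurableT_comp => //; exact: measurable_L1R.
    move=> x _; rewrite /= lee_fin normr_id.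
    by rewrite (ger0_norm (_ : 0 <= Num.min _ _)) ?le_min ?normr_ge0// ge_min lexx.
  - by apply: integrableS wsi.
  - by move=> x _; rewrite ge_min lexx orbT.
apply: (ae_imp3 dphi (wb s s0b) (ae_neq b)) => y H1 H2 yb.
rewrite /= in_itv/= => /andP[sy yt]; apply/esym/min_idPl.
have {}yb : y < b by rewrite lt_neqAle yb (le_trans yt).
have [_ <-] := H1 (introT andP (conj sy yb)).
rewrite zext_in; last by rewrite subr_gt0 sy ltrBlDr (lt_le_trans yb)// lerDl.
by apply: (le_trans (H2 _)); [rewrite !ltW|exact: ler_norm].
Qed.

Lemma primitive_vanishing (B : R -> R) : L1R B -> forall e : R, 0 < e ->
  exists2 d : R, 0 < d & forall x, x <= d -> \int[mu]_(s in `]0, x]) `|B s| < e.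
Proof.
move=> Bi e e0; have mB := measurable_L1R Bi.
have aBi : L1R (fun x => `|B x|) := integrable_abse Bi.
have lim : (\int[mu]_s ((0 < s <= n.+1%:R^-1)%R%:R * `|B s|))%R @[n --> \oo] --> (0 : R).
  rewrite [X in _ --> X](_ : 0 = \int[mu]_s (0 : R)); last by rewrite -[LHS](mul0r (fine (mu setT))) -Rintegral_cst.
  apply: (@Rintegral_dominated _ _ _ mu _ _ _ (fun s => `|B s|)) => //.
  - move=> n; apply: measurable_funM; last exact: measurableT_comp.
    apply: measurable_fun_natr_bool; apply: measurable_and; [exact: measurable_fun_ltr|exact: measurable_fun_ler].
  - move=> s _; apply: cvg_near_cst; have [s0|s0] := ltP 0 s; last first.
      by apply: nearW => n; rewrite /= mul0r.
    near=> n; rewrite (_ : (s <= _) = false) ?mul0r//; apply/negbTE; rewrite -ltNge.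
    near: n; exact: (near_infty_natSinv_lt (PosNum s0)).
  - move=> n s _; rewrite normrM normr_id.
    by case: (_ < _ <= _); rewrite ?normr1 ?normr0 ?mul1r ?mul0r.
have [N _ HN] := (cvgr_lt _ lim _ e0); exists (N.+1%:R^-1); first by rewrite invr_gt0.
move=> x xN; apply: le_lt_trans (HN N (leqnn N)); rewrite Rintegral_itv_bool.
have dom (c : R -> bool) : measurable_fun setT c -> L1R (fun s => (c s)%:R * `|B s|).
  move=> mc; have := aBi; apply: le_integrable => //.
    apply/measurable_EFinP/measurable_funM; last exact: measurableT_comp.
    exact: measurable_fun_natr_bool.
  by move=> s _; rewrite /= lee_fin normrM; case: (c s); rewrite ?normr1 ?normr0 ?mul1r ?mul0r.
apply: le_Rintegral => //.
- by apply: (dom (fun s => 0 < s <= x)); apply: measurable_and; [exact: measurable_fun_ltr|exact: measurable_fun_ler].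
- by apply: (dom (fun s => 0 < s <= N.+1%:R^-1)); apply: measurable_and; [exact: measurable_fun_ltr|exact: measurable_fun_ler].
- move=> s _; apply: ler_wpM2r => //; rewrite ler_nat; case: (0 < s) => //=.
  by have [sx|] := leP s x => //; rewrite (le_trans sx xN).
Unshelve. all: by end_near. Qed.

(* The bound on F makes it vanish at 0, which fixes the constant of integration. *)
Lemma weak_primitive (b : R) (F H B : R -> R) : L1R F -> L1R H -> L1R B ->
  (forall x, 0 < x < b -> `|F x| <= \int[mu]_(s in `]0, x]) `|B s|) ->
  (forall phi, test_function b phi ->
    \int[mu]_(t in `]0, b[) (F t * derive1 phi t) = - \int[mu]_(t in `]0, b[) (H t * phi t)) ->
  {ae mu, forall y, 0 < y < b -> F y = \int[mu]_(s in `]0, y]) H s}.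
Proof.
move=> Fi Hi Bi FB FH.
have lF : {ae mu, forall x, lebesgue_pt F x}.
  exact: (lebesgue_differentiation (open_integrable_locally openT Fi)).
apply: (ae_imp lF) => y ly /andP[y0 yb]; apply/eqP; rewrite -subr_eq0 -normr_le0.
apply/ler_addgt0Pl => e e0; rewrite addr0; have e20 : 0 < e / 2 by rewrite divr_gt0.
have [d1 d10 Hd1] := primitive_vanishing Bi e20.
have [d2 d20 Hd2] := primitive_vanishing Hi e20.
have d0 : 0 < Num.min y (Num.min d1 d2) by rewrite !lt_min y0 d10.
have [x /andP[x0]] := ae_exists d0 lF; rewrite !lt_min => /andP[xy /andP[xd1 xd2]] lx.
have E := weak_derivative_lebesgue_pt Fi Hi FH x0 xy yb lx ly.
have H0i : mu.-integrable `]0, y] (EFin \o H) by apply: integrableS Hi.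
have E2 := Rintegral_itvB H0i (ltW x0 : (BRight 0 <= BRight x)%O) (ltW xy : (BRight x <= BRight y)%O).
(* By the du Bois-Reymond lemma the difference between [F] and the primitive of [H] is the same at
   [y] and at [x]; at [x], chosen close to 0, both terms are small. *)
have -> : F y - \int[mu]_(s in `]0, y]) H s = F x - \int[mu]_(s in `]0, x]) H s.
  by move: E E2 => <-; lra.
apply: (le_trans (ler_normB _ _)); rewrite [e]splitr; apply: lerD.
  by apply: (le_trans (FB x _)); [rewrite x0 (lt_trans xy)|apply/ltW/Hd1/ltW].
apply: (le_trans (le_normr_Rintegral _ _)) => //; last by apply/ltW/Hd2/ltW.
by apply: integrableS Hi.
Qed.

End extension_and_truncation.

(** * Borel versions of the equations and the integrated identity *)

Section sonine_identity.
Context (R : realType).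
Notation mu := (@lebesgue_measure R).
Notation L1R f := (mu.-integrable [set: R] (EFin \o f)).

Lemma Rintegral_eq0 (D : set R) (f : R -> R) : measurable (D : set (measurableTypeR R)) ->
  (forall x, D x -> f x = 0) ->
  \int[mu]_(x in D) f x = 0.
Proof.
move=> mD f0; rewrite -[RHS](mul0r (fine (mu D))) -Rintegral_cst//; apply: eq_Rintegral.
by move=> x /set_mem; exact: f0.
Qed.

Lemma Rintegral_itv_ae (t : R) (f F : R -> R) :
  {ae mu, forall s, 0 < s < t -> f s = F s} -> (forall s, ~~ (0 < s < t) -> F s = 0) ->
  \int[mu]_(s in `]0, t[) f s = \int[mu]_s F s.
Proof.
move=> fF F0; rewrite Rintegral_mkcond; apply: ae_eq_Rintegral.
apply: (ae_imp fF) => s fFs _; rewrite patchE mem_setE in_itv /=.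
by case: ifPn => [/fFs//|/F0].
Qed.

Lemma triangle_measurable (b : R) :
  measurable ([set p | 0 <= p.1 /\ p.1 <= p.2 /\ p.2 <= b] :
    set (measurableTypeR R * measurableTypeR R)).
Proof.
rewrite (_ : [set p | _] = [set p : measurableTypeR R * measurableTypeR R |
    [&& 0 <= p.1, p.1 <= p.2 & p.2 <= b]]).
  apply: measurable_set_bool; apply: measurable_and; first exact: measurable_fun_ler.
  by apply: measurable_and; exact: measurable_fun_ler.
apply/seteqP; split => p /=; first by move=> [-> [-> ->]].
by move=> /and3P[].
Qed.

Lemma admissible_weight_version b w : admissible_weight b w ->
  exists2 B : R, 0 <= B & exists W : R * R -> R, [/\ measurable_fun setT W,
    forall p, `|W p| <= B &
    {ae (mu \x mu)%E, forall p, 0 <= p.1 /\ p.1 <= p.2 /\ p.2 <= b -> W p = w p.1 p.2}].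
Proof.
move=> wa; have [B B0 wB] := admissible_weight_bounded wa; exists B => //.
have [W' mW' WW'] := completed_restrict (triangle_measurable b) (aw_measurable wa).
exists (fun p => Num.max (- B) (Num.min B (W' p))); split.
- exact: measurable_clamp.
- by move=> p; exact: clamp_norm.
- apply: (ae_imp WW') => p Wp tp; rewrite -Wp// clampK//.
  by case: tp => ? [? ?]; exact: wB.
Qed.

Lemma measurable_kernelM (W : R * R -> R) (a : R -> R) : measurable_fun setT W ->
  measurable_fun setT a -> measurable_fun setT (fun p : R * R => W p * a (p.2 - p.1)).
Proof. by move=> mW ma; apply: measurable_funM => //; exact: measurable_conv_kernel. Qed.

Lemma first_kind_version (b : R) (w : R -> R -> R) (W : R * R -> R) (k u : R -> R) :
  {ae (mu \x mu)%E, forall p, 0 <= p.1 /\ p.1 <= p.2 /\ p.2 <= b -> W p = w p.1 p.2} ->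
  {ae mu, forall t, 0 < t < b ->
    \int[mu]_(s in `]0, t[) (w s t * k (t - s) * u s) =
    \int[mu]_s (W (s, t) * zext b k (t - s) * zext b u s)}.
Proof.
move=> /prod_ae2 WW; apply: (ae_imp WW) => t Wt /andP[t0 tb].
apply: Rintegral_itv_ae => [|s].
  apply: (ae_imp Wt) => s Ws /andP[s0 st]; rewrite Ws /= ?ltW//.
  by rewrite !zext_in ?s0 ?(lt_trans st)// subr_gt0 st ltrBlDr (lt_trans tb)// ltrDl.
rewrite negb_and -!leNgt => /orP[s0|ts]; first by rewrite (zext_le0 _ _ s0) mulr0.
by rewrite (@zext_le0 _ _ _ (t - s)) ?subr_le0// mulr0 mul0r.
Qed.

(** The substitution r = s + z presents g(s, x) as the convolution of [K] with the section of W (s,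
    r) k (r - s), evaluated at s + x. This is the inner integral that [kernel_fubini] produces. *)
Lemma sonine_version (b : R) (w g : R -> R -> R) (W : R * R -> R) (k K : R -> R) :
  WSC1 b w k K g -> measurable_fun setT W ->
  {ae (mu \x mu)%E, forall p, 0 <= p.1 /\ p.1 <= p.2 /\ p.2 <= b -> W p = w p.1 p.2} ->
  {ae mu, forall s, 0 < s < b -> {ae mu, forall x, 0 < x < b - s -> g s x =
    \int[mu]_r (zext b K (s + x - r) * (W (s, r) * zext b k (r - s)))}}.
Proof.
move=> wsc mW /prod_ae1 WW; apply: (ae_imp WW) => s Ws /andP[s0 sb].
have mk := measurable_L1R (zext_integrable (wsc1_k wsc)).
have mK := measurable_L1R (zext_integrable (wsc1_K wsc)).
have s0b : 0 <= s <= b by rewrite !ltW.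
apply: (ae_imp (wsc1_eq wsc s0b)) => x gx /[dup] xbs /andP[x0 xb]; rewrite -gx//.
have xb' : x < b by rewrite (lt_trans xb)// ltrBlDr ltrDl.
pose h z := zext b K (x - z) * (W (s, s + z) * zext b k z).
have mh : measurable_fun setT h.
  apply: measurable_funM; first by apply: (measurableT_comp mK); exact: measurable_funB.
  apply: measurable_funM => //; apply: (measurableT_comp mW).
  by apply: measurable_fun_pair => //; exact: measurable_funD.
transitivity (\int[mu]_z h z); last first.
  rewrite -(Rintegral_shift s mh); apply: eq_Rintegral => r _; rewrite /h.
  have -> : x - (r - s) = s + x - r by ring.
  by have -> : s + (r - s) = r by ring.
apply: Rintegral_itv_ae => [|z].
  apply: (ae_imp (ae_shift (- s) Ws)) => z; rewrite opprK /= => Wz /andP[z0 zx].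
  rewrite /h !zext_in ?z0 ?(lt_trans zx)//; last first.
    by rewrite subr_gt0 zx ltrBlDr (lt_trans xb')// ltrDl.
  rewrite [s + z]addrC Wz ?mulrA; first by rewrite [_ * w _ _]mulrC.
  rewrite ltW// lerDr ltW//; split=> //; split => //.
  by rewrite -lerBrDr ltW// (lt_trans zx).
rewrite negb_and -!leNgt /h => /orP[z0|xz]; first by rewrite (zext_le0 _ _ z0) !mulr0.
by rewrite (@zext_le0 _ _ _ (x - z)) ?subr_le0// mul0r.
Qed.

(** [V] and [H] are integrable functions on the whole line that represent the left-hand sides of the
    two equations, the second one multiplied by g(t, 0), so that convolutions and primitives can be
    taken freely. *)
Lemma sonine_kernel_identity (b : R) (w g : R -> R -> R) (k K u : R -> R) :
  admissible_weight b w -> WSC1 b w k K g -> L1 b u ->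
  exists V H : R -> R, [/\ L1R V /\ (forall t, t <= 0 -> V t = 0),
    {ae mu, forall t, 0 < t < b ->
      \int[mu]_(s in `]0, t[) (w s t * k (t - s) * u s) = V t},
    L1R H,
    {ae mu, forall t, 0 < t < b ->
      g t 0 * u t + \int[mu]_(s in `]0, t[) (derive1 (g s) (t - s) * u s) = H t} &
    {ae mu, forall t, 0 < t < b ->
      \int[mu]_s (zext b K (t - s) * V s) = \int[mu]_(s in `]0, t]) H s}].
Proof.
move=> wa wsc ub; have [B B0 [W [mW WB WW]]] := admissible_weight_version wa.
have [m [M [/andP[m0 mM] gM]]] := wsc1_trace wsc.
have M0 : 0 <= M := le_trans (ltW m0) mM.
have [gbar gbi gbg] := wsc1_deriv wsc.
have ui := zext_integrable ub; have ki := zext_integrable (wsc1_k wsc).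
have Ki := zext_integrable (wsc1_K wsc); have gi := zext_integrable gbi.
have mk := measurable_L1R ki; have mK := measurable_L1R Ki.
pose N1 (p : R * R) := W p * zext b k (p.2 - p.1).
have mN1 : measurable_fun setT N1 by exact: measurable_kernelM.
have Bki : L1R (fun x => B * `|zext b k x|).
  by have := integrableZl measurableT B (integrable_abse ki); apply: eq_integrable.
have N1B s t : `|N1 (s, t)| <= B * `|zext b k (t - s)| by rewrite /N1 normrM ler_wpM2r.
pose V t := \int[mu]_s (N1 (s, t) * zext b u s).
have Vi : L1R V := integrable_Rintegral2 (integrable_kernel Bki ui mN1 N1B).
(* [J (s, t)] stands for g(s, t - s), with which it agrees on 0 < s < t < b for almost every [s] and
   then almost every [t]; it is Borel by construction. *)
pose J (p : R * R) := \int[mu]_r (zext b K (p.2 - r) * N1 (p.1, r)).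
have mJ : measurable_fun setT J.
  have mF : measurable_fun setT (fun q : (R * R) * R => zext b K (q.1.2 - q.2) * N1 (q.1.1, q.2)).
    apply: measurable_funM.
      apply: (measurableT_comp mK); apply: measurable_funB => //.
      exact: (measurableT_comp measurable_snd measurable_fst).
    apply: (measurableT_comp mN1); apply: measurable_fun_pair => //.
    exact: (measurableT_comp measurable_fst measurable_fst).
  exact: (@measurable_Rintegral1 _ _ _ _ _ mu _ mF).
pose P (p : R * R) := J (p.1, p.1 + p.2).
have mP : measurable_fun setT P.
  apply: (measurableT_comp mJ); apply: measurable_fun_pair => //.
  exact: measurable_funD.
have gP := sonine_version wsc mW WW.
have gbg' s : 0 <= s <= b -> {ae mu, forall x, 0 < x < b - s ->
    `|derive1 (g s) x| <= zext b gbar x}.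
  move=> sb; apply: (ae_imp (gbg s sb)) => x H /andP[x0 xb].
  have xb' : x < b by apply: (lt_le_trans xb); rewrite lerBlDr lerDl; case/andP: sb.
  by rewrite zext_in ?x0// H// !ltW.
have [N2 [c [mN2 mc N2g cE dN2]]] :=
  section_derivative_version gi mP (wsc1_abs_cont wsc) gbg' gP.
(* [c] equals the trace only almost everywhere; the clamp gives it the bound [M] everywhere, which
   keeps the product with [u] integrable. *)
pose c' s := Num.max (- M) (Num.min M (c s)).
have mc' : measurable_fun setT c' by exact: measurable_clamp.
have cM s : `|c' s| <= M by exact: clamp_norm.
have c'E s : 0 < s < b -> c s = g s 0 -> c' s = g s 0.
  move=> /andP[s0 sb] csE; rewrite /c' csE clampK//.
  by have /andP[] : m <= `|g s 0| <= M by rewrite gM// !ltW.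
have un0 s : s <= 0 -> zext b u s = 0 by exact: zext_le0.
have [Gi PK] := @primitive_kernel R b M _ _ _ N2 ui un0 mc' cM gi mN2 N2g.
set G := (fun r => _) in Gi PK.
pose H r := zext b u r * c' r + G r.
have Hi : L1R H.
  have uci : L1R (fun r => zext b u r * c' r) by exact: (integrableM_bounded measurableT ui mc').
  by have := integrableD measurableT uci Gi; apply: eq_integrable.
exists V, H; split => //.
- split=> // t t0; apply: Rintegral_eq0 => // s _; rewrite /N1 /=.
  have [s0|s0] := leP s 0; first by rewrite un0// mulr0.
  by rewrite (@zext_le0 _ _ k) ?mulr0 ?mul0r// subr_le0 (le_trans t0)// ltW.
- exact: (first_kind_version k u WW).
- apply: (ae_imp2 cE dN2) => t ct dt tb; have [ctE _] := ct tb; have /andP[t0 t1] := tb.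
  rewrite /H c'E// zext_in// mulrC; congr (_ + _); apply: Rintegral_itv_ae => [|s].
    apply: (ae_imp (dt tb)) => s ds st; have /andP[s0 s1] := st.
    by rewrite ds// s1 mul1r zext_in// s0 (lt_trans s1).
  rewrite negb_and -!leNgt => /orP[s0|ts]; first by rewrite un0// mulr0.
  by rewrite ltNge ts !mul0r.
(* The identity is known for almost every [s] at almost every [t] and is needed in the reverse
   order. Written with [J], [c'] and [N2] instead of [g], it defines a Borel set, to which [ae_swap]
   applies. *)
pose A := [set p : measurableTypeR R * measurableTypeR R |
  [&& 0 < p.1, p.1 < b, p.1 < p.2 & p.2 < b] ==>
  (J p == c' p.1 + \int[mu]_y ((0 < y <= p.2 - p.1)%R%:R * N2 (p.1, y)))].
have mA : measurable A.
  apply: measurable_set_bool; under eq_fun do rewrite implybE.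
  have mlt (f1 f2 : R * R -> R) : measurable_fun setT f1 -> measurable_fun setT f2 ->
    measurable_fun setT (fun p => f1 p < f2 p) by move=> ? ?; exact: measurable_fun_ltr.
  apply: measurable_or; first by apply: measurable_neg; do ![apply: measurable_and]; exact: mlt.
  apply: measurable_fun_eqr => //; apply: measurable_funD; first exact: measurableT_comp.
  apply: (@measurable_Rintegral1 _ _ _ _ _ mu
    (fun q : (R * R) * R => (0 < q.2 <= q.1.2 - q.1.1)%R%:R * N2 (q.1.1, q.2))).
  have m12 : measurable_fun setT (fun q : (R * R) * R => q.1.2).
    exact: (measurableT_comp measurable_snd measurable_fst).
  have m11 : measurable_fun setT (fun q : (R * R) * R => q.1.1).
    exact: (measurableT_comp measurable_fst measurable_fst).
  apply: measurable_funM.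
    apply: measurable_fun_natr_bool; apply: measurable_and; first exact: measurable_fun_ltr.
    by apply: measurable_fun_ler => //; exact: measurable_funB.
  by apply: (measurableT_comp mN2); exact: measurable_fun_pair.
have AA : {ae mu, forall s, {ae mu, forall t, A (s, t)}}.
  apply: (ae_imp2 gP cE) => s gPs cs.
  have [/andP[s0 sb]|sb] := boolP (0 < s < b); last first.
    by apply: aeW => t; rewrite /A /= andbA (negbTE sb).
  have sb' : 0 < s < b by rewrite s0.
  have [csE gE] := cs sb'.
  apply: (ae_imp (ae_shift s (gPs sb'))) => t gt; apply/implyP => /= /and4P[_ _ st tb].
  have ts : 0 < t - s < b - s by rewrite subr_gt0 st ltrD2r.
  rewrite -Rintegral_itv_bool c'E// -gE; last by case/andP: ts => ? ?; rewrite !ltW.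
  by apply/eqP; rewrite gt// addrC subrK.
have {AA}AA := @ae_swap _ _ _ _ _ mu mu _ mA AA.
have KF := kernel_fubini Ki Bki ui mN1 N1B.
apply: (ae_imp3 AA KF PK) => t At KFt PKt tb; rewrite -PKt// KFt.
apply: ae_eq_Rintegral; apply: (ae_imp At) => s Ats _.
have [sb|sb] := boolP (0 < s < b); last by rewrite zext_out ?mul0r.
have /andP[s0 s1] := sb; have /andP[_ t1] := tb.
congr (_ * _); have [st|ts] := ltP s t.
  move: Ats => /implyP/=; rewrite s0 s1 st t1 => /(_ isT)/eqP JE.
  by rewrite mul1r Rintegral_itv_bool -JE.
rewrite mul0r; apply: Rintegral_eq0 => // r _; rewrite /N1 /=.
have [rs|sr] := leP r s; first by rewrite (@zext_le0 _ _ k) ?subr_le0// !mulr0.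
by rewrite (@zext_le0 _ _ K) ?mul0r// subr_le0 ltW// (le_lt_trans ts).
Qed.

End sonine_identity.

(** * Injectivity of convolution with the associated kernel *)

Section uniqueness.
Context (R : realType).
Notation mu := (@lebesgue_measure R).
Notation L1R f := (mu.-integrable [set: R] (EFin \o f)).

(** With [k0] = w(0, .) k, the Sonine condition at s = 0 says that K * k0 is g(0, .), an absolutely
    continuous function; its value at 0 is nonzero by the lower bound on the trace, as
    [volterra_unique] demands. *)
Lemma sonine_convolution_injective (b : R) (w g : R -> R -> R) (k K r : R -> R) :
  0 < b -> admissible_weight b w -> WSC1 b w k K g -> L1R r ->
  (forall x, ~~ (0 < x < b) -> r x = 0) ->
  {ae mu, forall t, 0 < t < b -> \int[mu]_s (zext b K (t - s) * r s) = 0} ->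
  {ae mu, forall t, r t = 0}.
Proof.
move=> b0 wa wsc ri r0 Kr; have [B B0 wB] := admissible_weight_bounded wa.
have ki := zext_integrable (wsc1_k wsc); have Ki := zext_integrable (wsc1_K wsc).
have b00 : (0 : R) <= 0 <= b by rewrite lexx ltW.
have [psi psii psiE] := absolutely_continuous_density (ltW b0) (aw_abs_cont wa b00).
have b0s : 0 <= b - 0 by rewrite subr0 ltW.
have [phi phii phiE] := absolutely_continuous_density b0s (wsc1_abs_cont wsc b00).
(* A Borel function on the line that agrees with [w 0] on [0, b]; clamping it by [B] makes [k0]
   integrable. *)
pose w0 x := w 0 0 + \int[mu]_(y in `]0, x]) psi y.
have mw0 : measurable_fun setT w0.
  apply: measurable_funD => //.
  under eq_fun do rewrite Rintegral_itv_bool.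
  apply: (@measurable_Rintegral1 _ _ _ _ _ mu (fun q : R * R => (0 < q.2 <= q.1)%R%:R * psi q.2)).
  apply: measurable_funM; last exact: (measurableT_comp (measurable_L1R psii)).
  by apply: measurable_fun_natr_bool; apply: measurable_and; [exact: measurable_fun_ltr|exact: measurable_fun_ler].
pose k0 x := zext b k x * Num.max (- B) (Num.min B (w0 x)).
have k0i : L1R k0.
  apply: (integrableM_bounded measurableT ki (measurable_clamp B mw0)) => x _.
  exact: clamp_norm.
have c00 : g 0 0 != 0.
  have [m [M [/andP[m0 mM] gM]]] := wsc1_trace wsc.
  by have /andP[gm _] := gM 0 b00; rewrite -normr_gt0 (lt_le_trans m0).
apply: (volterra_unique (b := b) Ki k0i phii ri c00) => //.
- exact: zext_le0.
- by move=> x x0; rewrite /k0 zext_le0// mul0r.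
apply: (ae_imp (wsc1_eq wsc b00)) => x gx /andP[x0 xb].
rewrite -phiE ?subr0 ?ltW// addrC subrK -gx ?subr0 ?x0//; apply/esym.
apply: Rintegral_itv_ae => [|z].
  apply: aeW => z /andP[z0 zx]; have zb : z < b := lt_trans zx xb.
  have wE : w0 z = w 0 z by rewrite /w0 -psiE ?ltW ?z0// addrC subrK.
  have KE : zext b K (x - z) = K (x - z).
    by rewrite zext_in// subr_gt0 zx ltrBlDr (lt_trans xb)// ltrDl.
  rewrite /k0 wE KE zext_in ?z0// clampK; first by rewrite addr0; ring.
  by apply: wB; rewrite ?lexx ?ltW.
rewrite negb_and -!leNgt => /orP[z0|xz]; first by rewrite /k0 (zext_le0 b k z0) mul0r mulr0.
by rewrite zext_le0 ?mul0r// subr_le0.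
Qed.

End uniqueness.

(** * Bounded right-hand sides and the conclusion *)

Section bounded_convolution.
Context (R : realType).
Notation mu := (@lebesgue_measure R).
Notation L1R f := (mu.-integrable [set: R] (EFin \o f)).

(** After a reflection the bounded factor is estimated by [M], and causality leaves only ]0, x]. The
    bound is itself a primitive, in the form that [weak_primitive] takes. *)
Lemma convolution_bound (M : R) (K f : R -> R) : L1R K -> (forall x, x <= 0 -> K x = 0) ->
  measurable_fun setT f -> (forall x, `|f x| <= M) -> (forall x, x <= 0 -> f x = 0) ->
  forall x, `|\int[mu]_s (K (x - s) * f s)| <= \int[mu]_(s in `]0, x]) `|M * K s|.
Proof.
move=> Ki K0 mf fM f0 x; have mK := measurable_L1R Ki.
have mfx : measurable_fun setT (fun z : R => f (x - z)).
  by apply: (measurableT_comp mf); exact: measurable_funB.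
have hi : L1R (fun z : R => K z * f (x - z)).
  by apply: (integrableM_bounded measurableT Ki mfx) => z _; exact: fM.
rewrite (_ : \int[mu]_s _ = \int[mu]_z (K z * f (x - z))); last first.
  rewrite -(Rintegral_reflect x (measurable_L1R hi)); apply: eq_Rintegral => s _.
  by rewrite subKr.
apply: (le_trans (le_normr_Rintegral _ hi)) => //; rewrite Rintegral_itv_bool.
have MKi : L1R (fun z => `|M * K z|).
  by have := integrable_abse (integrableZl measurableT M Ki); apply: eq_integrable.
apply: le_Rintegral => //.
- exact: (integrable_abse hi).
- have := MKi; apply: le_integrable => //.
    apply/measurable_EFinP/measurable_funM; last exact: measurable_L1R MKi.
    by apply: measurable_fun_natr_bool; apply: measurable_and; [exact: measurable_fun_ltr|exact: measurable_fun_ler].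
  by move=> z _; rewrite /= lee_fin normrM; case: (_ < _ <= _); rewrite ?normr1 ?normr0 ?mul1r ?mul0r.
- move=> z _; have [z0|z0] := leP z 0; first by rewrite K0// mul0r normr0 mulr_ge0.
  have [zx|xz] := leP z x; last by rewrite f0 ?mulr0 ?normr0 ?mulr_ge0// subr_le0 ltW.
  rewrite mul1r mulrC !normrM ler_wpM2r// (le_trans (fM _))//; exact: ler_norm.
Qed.

End bounded_convolution.

Theorem theorem3p2 (R : realType) (b : R) (w : R -> R -> R) (k K : R -> R)
    (g : R -> R -> R) (f : R -> R) (b_gt0 : 0 < b)
    (w_adm : admissible_weight b w)
    (k_wsc1 : WSC1 b w k K g)
    (f_meas : completed_measurable_fun (@lebesgue_measure R) `]0, b[ f)
    (f_bnd : exists M : R, forall t : R, 0 < t < b -> `|f t| <= M)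
    (u : R -> R) (u_L1 : L1 b u)
    (u_sol : solves_second_kind b K g f u) :
  solves_first_kind b w k f u.
Proof.
pose mu := @lebesgue_measure R.
have [V [H [[Vi V0] uV Hi uH KV]]] := sonine_kernel_identity w_adm k_wsc1 u_L1.
have [M fM] := f_bnd; have [h [_ _ weakh] uh] := u_sol.
have Ki := zext_integrable (wsc1_K k_wsc1).
have mD : measurable (`]0, b[%classic : set (measurableTypeR R)) by exact: measurable_itv.
have [f' mf' ff'] := completed_restrict mD f_meas.
(* A bounded Borel version of [f] on the line, clamped at [|M|] since [clamp_norm] asks for a
   nonnegative bound. *)
pose fE x := (0 < x < b)%R%:R * Num.max (- `|M|) (Num.min `|M| (f' x)).
have fEi : mu.-integrable setT (EFin \o fE).
  apply: (integrableM_bounded measurableT (integrable_itv_bool b) (measurable_clamp `|M| mf')).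
  by move=> x _; exact: clamp_norm.
have fE0 x : ~~ (0 < x < b) -> fE x = 0 by rewrite /fE => /negbTE ->; rewrite mul0r.
have fEle0 x : x <= 0 -> fE x = 0 by move=> x0; rewrite fE0// negb_and -leNgt x0.
have fEM x : `|fE x| <= `|M|.
  by rewrite /fE; case: (_ < _ < _); rewrite ?mul0r ?normr0// mul1r clamp_norm.
have ffE : {ae mu, forall x, 0 < x < b -> f x = fE x}.
  apply: (ae_imp ff') => x fx xb; rewrite /fE xb mul1r -fx; last by rewrite /= in_itv/=.
  by rewrite clampK// (le_trans (fM x xb))// ler_norm.
pose F t := \int[mu]_s (zext b K (t - s) * fE s).
have FE t : 0 < t < b -> \int[mu]_(s in `]0, t[) (K (t - s) * f s) = F t.
  move=> /andP[t0 tb]; apply: Rintegral_itv_ae => [|s].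
    apply: (ae_imp ffE) => s fs /andP[s0 st]; rewrite fs ?s0 ?(lt_trans st)//.
    by rewrite zext_in// subr_gt0 st ltrBlDr (lt_trans tb)// ltrDl.
  rewrite negb_and -!leNgt => /orP[s0|ts]; first by rewrite fEle0// mulr0.
  by rewrite zext_le0 ?mul0r// subr_le0.
have kerN (d : R -> R) : mu.-integrable setT (EFin \o d) ->
    (mu \x mu)%E.-integrable setT (EFin \o (fun p : R * R => zext b K (p.2 - p.1) * d p.1)).
  move=> di; apply: (integrable_kernel (integrable_abse Ki) di) => //.
  exact: (measurable_conv_kernel (measurable_L1R Ki)).
have Fi : mu.-integrable setT (EFin \o F) := integrable_Rintegral2 (kerN _ fEi).
have Hh : {ae mu, forall t, 0 < t < b -> h t = H t}.
  apply: (ae_imp2 uH uh) => t uHt uht tb.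
  have g0 : g t 0 != 0.
    have [m [N [/andP[m0 mN] gN]]] := wsc1_trace k_wsc1; have /andP[t0 t1] := tb.
    have /andP[gm _] : m <= `|g t 0| <= N by apply: gN; rewrite !ltW.
    by rewrite -normr_gt0 (lt_le_trans m0).
  rewrite -uHt//; apply: (mulfI (invr_neq0 g0)); rewrite -uht//.
  by rewrite mulrDr mulKf.
have FH : {ae mu, forall t, 0 < t < b -> F t = \int[mu]_(s in `]0, t]) H s}.
  have MKi : mu.-integrable setT (EFin \o (fun x => `|M| * zext b K x)).
    by have := integrableZl measurableT `|M| Ki; apply: eq_integrable.
  apply: (weak_primitive (b := b) Fi Hi MKi) => [x xb|phi tphi].
    exact: (convolution_bound Ki (@zext_le0 _ b K) (measurable_L1R fEi) fEM fEle0).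
  transitivity (\int[mu]_(t in `]0, b[)
    (\int[mu]_(s in `]0, t[) (K (t - s) * f s) * derive1 phi t)).
    by apply: eq_Rintegral => t; rewrite inE/= in_itv/= => tb; rewrite FE.
  rewrite weakh//; congr (- _); apply: ae_eq_Rintegral.
  by apply: (ae_imp Hh) => t Ht; rewrite /= in_itv/= => tb; rewrite Ht.
have zVi : mu.-integrable setT (EFin \o zext b V).
  by apply: zext_integrable; apply: integrableS Vi.
pose r x := zext b V x - fE x.
have ri : mu.-integrable setT (EFin \o r).
  by have := integrableB measurableT zVi fEi; apply: eq_integrable.
have r0 x : ~~ (0 < x < b) -> r x = 0 by move=> xb; rewrite /r zext_out// fE0// subrr.
have Kr : {ae mu, forall t, 0 < t < b -> \int[mu]_s (zext b K (t - s) * r s) = 0}.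
  have iV := ae_integrable2 (kerN _ zVi); have iF := ae_integrable2 (kerN _ fEi).
  apply: (ae_imp2 (ae_imp2 iV iF (fun t p q => conj p q)) (ae_imp2 KV FH (fun t p q => conj p q))).
  move=> t [iVt iFt] [KVt FHt] tb; have /andP[t0 t1] := tb.
  have iVt' : mu.-integrable setT (EFin \o (fun s => zext b K (t - s) * zext b V s)) := iVt.
  have iFt' : mu.-integrable setT (EFin \o (fun s => zext b K (t - s) * fE s)) := iFt.
  under eq_Rintegral do rewrite /r mulrBr.
  rewrite RintegralB// [X in _ - X](FHt tb) -KVt//; apply/eqP; rewrite subr_eq0; apply/eqP.
  (* [KV] involves [V] itself, [r] its truncation. Outside ]0, b[, where they may differ, either [V]
     vanishes (s <= 0) or the extended [K] does at t - s (s >= b > t). *)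
  apply: eq_Rintegral => s _; have [sb|sb] := boolP (0 < s < b); first by rewrite (zext_in V sb).
  have [s0|s0] := leP s 0; first by rewrite (zext_out V sb) V0.
  rewrite (@zext_le0 _ _ K) ?mul0r// subr_le0 (le_trans (ltW t1))// leNgt.
  by apply/negP => sb'; move: sb; rewrite s0 sb'.
have rz := sonine_convolution_injective b_gt0 w_adm k_wsc1 ri r0 Kr.
(* The first-kind equation includes t = b, which the identities on ]0, b[ do not reach; this single
   point is discarded as a null set. *)
apply: (ae_imp2 (ae_imp2 rz ffE (fun t p q => conj p q)) (ae_imp2 (ae_neq b) uV (fun t p q => conj p q))).
move=> t [rt ft] [tb uVt] /andP[t0 t1].
have tb' : 0 < t < b by rewrite t0 lt_neqAle tb.
rewrite uVt// ft//; apply/eqP; rewrite -subr_eq0; apply/eqP.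
by move: rt; rewrite /r zext_in.
Qed.
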